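(* Let $G$ be a finite simple graph that has no induced subgraph isomorphic to $K_3$ and no induced subgraph isomorphic to the fork. Then $\chi(G)\le 3$.
   Context: The fork (also called trident) is the tree obtained from $K_{1,4}$ by subdividing two of its edges once each: it has $7$ vertices $w_1,\dots,w_7$ and edges $w_1w_2, w_2w_3, w_1w_4, w_4w_5, w_1w_6, w_1w_7$. For a family $\mathcal{H}$ of graphs, a graph is $\mathcal{H}$-free if it has no induced subgraph isomorphic to any member of $\mathcal{H}$. $\chi(G)$ denotes the chromatic number of $G$. *)

(* Defs.v *)
From mathcomp Require Import all_boot.

Set Implicit Arguments.
Unset Strict Implicit.
Unset Printing Implicit Defensive.

Record sgraph := SGraph {
  vertex :> finType;
  adj : rel vertex;
  adj_sym : symmetric adj;
  adj_irrefl : irreflexive adj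
}.

Section Induced.
Variables (G : sgraph) (S : {set G}).

Definition induced_adj : rel {x : G | x \in S} :=
  fun x y => adj (val x) (val y).

Lemma induced_adj_sym : symmetric induced_adj.
Proof. by move=> x y; apply: adj_sym. Qed.

Lemma induced_adj_irrefl : irreflexive induced_adj.
Proof. by move=> x; apply: adj_irrefl. Qed.

Definition induced : sgraph := SGraph induced_adj_sym induced_adj_irrefl.
End Induced.

Definition isomorphic (G H : sgraph) : Prop :=
  exists2 f : G -> H, bijective f & forall x y, adj (f x) (f y) = adj x y.

Definition has_induced (G H : sgraph) : Prop :=
  exists S : {set G}, isomorphic (induced S) H.

Section Complete.
Variable n : nat.

Definition complete_adj : rel 'I_n := fun x y => x != y.

Lemma complete_adj_sym : symmetric complete_adj.
Proof. by move=> x y; rewrite /complete_adj eq_sym. Qed.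

Lemma complete_adj_irrefl : irreflexive complete_adj.
Proof. by move=> x; rewrite /complete_adj eqxx. Qed.

Definition complete : sgraph := SGraph complete_adj_sym complete_adj_irrefl.
End Complete.

(* The vertex w_i of the fork is the ordinal i - 1. *)
Definition fork_edges : seq (nat * nat) :=
  [:: (0, 1); (1, 2); (0, 3); (3, 4); (0, 5); (0, 6)].

Definition fork_adj : rel 'I_7 := fun x y =>
  ((val x, val y) \in fork_edges) || ((val y, val x) \in fork_edges).

Lemma fork_adj_sym : symmetric fork_adj.
Proof. by move=> x y; rewrite /fork_adj orbC. Qed.

Lemma fork_adj_irrefl : irreflexive fork_adj.
Proof. by case; do 7?case=> //. Qed.

Definition fork : sgraph := SGraph fork_adj_sym fork_adj_irrefl.

Definition colorable (G : sgraph) (k : nat) : bool :=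
  [exists c : {ffun G -> 'I_k},
    [forall x, forall y, adj x y ==> (c x != c y)]].

Lemma colorable_card (G : sgraph) : colorable G #|G|.
Proof.
apply/existsP; exists [ffun x => enum_rank x].
apply/forallP=> x; apply/forallP=> y; apply/implyP=> xy.
rewrite !ffunE (inj_eq enum_rank_inj).
by apply: contraTneq xy => ->; rewrite adj_irrefl.
Qed.

Lemma colorable_ex (G : sgraph) : exists k, colorable G k.
Proof. by exists #|G|; apply: colorable_card. Qed.

Definition chromatic_number (G : sgraph) : nat := ex_minn (colorable_ex G).

(* Main.v *)
Require Import Defs.
From mathcomp Require Import all_boot zify.

(** Let [G] be a smallest triangle-free and fork-free graph that is not 3-colourable.  Then
no neighbourhood contains another one, and all degrees are at least three
([colorable3_reduction]).  Among the maximum stable sets [S] of least degree sum take one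
for which the number of non-bipartite components of [G - S] is least ([optimal]).  If there
is no such component, [S] is the third colour class of a 3-colouring.  So let [K] be one of
them; the aim is a contradiction.

A vertex off [S] is called light if it has exactly one neighbour in [S], and heavy
otherwise.  Two principles govern the surroundings of [K].  A stable set disjoint from [S]
has at least as many neighbours in [S] as elements ([max_stable_hall]); in particular
distinct light vertices have distinct neighbours in [S].  And at a heavy vertex [x] the
absence of forks forces the sets of [S]-neighbours of any two neighbours of [x] off [S] to
be comparable ([heavy_chain]).

A shortest odd closed walk in [K] is an induced cycle of length at least five.  If its
length is at least seven, certain patterns of light (L) and heavy (H) vertices along the
cycle are impossible, and together they leave only the pattern in which all vertices are
light ([all_light]).  Moreover no further vertex off [S] is attached to the cycle, for any
length ([no_off_cycle]).  Hence [K] is the cycle.  Each of these exclusions is a finite case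
analysis on at most fourteen vertices.  They are carried out in a small tableau calculus:
its rules are shown to be sound once and for all ([refutesP]), and each case analysis is an
explicit tree that is checked by evaluation.

In a pentagon with a heavy vertex there is a light vertex [v] whose neighbour [s] in [S] is
adjacent to another vertex of the pentagon.  Exchanging [v] and [s] would then leave fewer
non-bipartite components ([optimal_light]).  So [K] is an odd cycle of light vertices, all of
degree three.  Now exchange a vertex [w] of [K] with its neighbour [s] in [S].  This turns [K]
into a path, so by the choice of [S] the vertex [s] must lie on a new odd cycle, and the new
stable set is as good as the old one ([swap_optimal]).  As in the proof of Brooks' theorem the
exchange can be repeated, each time with a vertex different from the one at which the current
cycle was entered.  The paths left behind are never met again ([dead_end_step]), which is
impossible in a finite graph. *)

Set Implicit Arguments.
Unset Strict Implicit.
Unset Printing Implicit Defensive.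

(** * Induced triangles and forks *)

Lemma embedding_has_induced (G H : sgraph) (f : H -> G) :
  injective f -> (forall x y, adj (f x) (f y) = adj x y) -> has_induced G H.
Proof.
move=> f_inj f_adj; pose S := [set y | y \in codom f]; exists S.
have codomP (u : {y | y \in S}) : val u \in codom f.
  by have := valP u; rewrite inE.
have inS x : f x \in S by rewrite inE codom_f.
exists (fun u => iinv (codomP u)).
  exists (fun x => exist _ (f x) (inS x)) => [u | x].
    by apply: val_inj; rewrite /= f_iinv.
  by apply: f_inj; rewrite f_iinv.
by move=> u v; rewrite -f_adj !f_iinv.
Qed.

Definition triangle_free (G : sgraph) :=
  forall x y z : G, adj x y -> adj y z -> ~~ adj x z.

(** The centre is [v], the two long legs are [v p x] and [v q y], the two leaves are
[g] and [h].  In a triangle-free graph vertices with a common neighbour are never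
adjacent, so the non-edges listed here are the only ones that remain to be checked. *)
Definition fork_free (G : sgraph) :=
  forall v p x q y g h : G, g != h ->
    all2 (@adj G) [:: v; p; v; q; v; v] [:: p; x; q; y; g; h] ->
    ~~ all2 (fun a b => ~~ adj a b)
       [:: x; x; x; x; y; y; y] [:: q; y; g; h; p; g; h].

Lemma triangle_freeP (G : sgraph) :
  ~ has_induced G (complete 3) -> triangle_free G.
Proof.
move=> noK3 x y z xy yz; apply/negP => xz; apply: noK3.
pose f (i : complete 3) := nth x [:: x; y; z] (i : 'I_3).
have f_adj i j : adj (f i) (f j) = adj i j.
  by case: i j => [[|[|[|//]]] ?] [[|[|[|//]]] ?];
    rewrite /= /complete_adj ?adj_irrefl //= ?xy ?yz ?xz // adj_sym ?xy ?yz ?xz.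
apply: (@embedding_has_induced _ _ f _ f_adj) => i j fij.
by have := f_adj i j; rewrite fij adj_irrefl /= /complete_adj => /esym/negbFE/eqP.
Qed.

(** No two vertices of the fork have the same neighbourhood except the two leaves at the
centre, so seven vertices with the adjacencies of the fork are distinct once [g != h]. *)
Lemma fork_freeP (G : sgraph) :
  triangle_free G -> ~ has_induced G fork -> fork_free G.
Proof.
move=> tf noF v p x q y g h gh.
rewrite /= !andbT => /and5P [vp px vq qy /andP [vg vh]]; apply/negP.
case/and5P => xq xy xg xh /and3P [yp yg yh]; apply: noF.
(* Vertices at distance two in the tree have a common neighbour. *)
have near (a b c : G) : adj a b -> adj a c -> ~~ adj b c.
  by move=> ab ac; have := tf b a c; rewrite adj_sym; apply.
have far := (near _ _ _ vp vq, near _ _ _ vp vg, near _ _ _ vp vh,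
  near _ _ _ vq vg, near _ _ _ vq vh, near _ _ _ vg vh, tf _ _ _ vp px,
  tf _ _ _ vq qy).
have edges := (vp, px, vq, qy, vg, vh).
pose f (i : fork) := nth v [:: v; p; x; q; y; g; h] (i : 'I_7).
have f_adj i j : adj (f i) (f j) = adj i j.
  have sym a b : adj a b = adj b a := adj_sym a b.
  case: i j => [[|[|[|[|[|[|[|//]]]]]]] ?] [[|[|[|[|[|[|[|//]]]]]]] ?];
    rewrite /= /fork_adj /= ?adj_irrefl ?edges //; try (by apply/negbTE; rewrite ?far);
    by [rewrite sym ?edges | apply/negbTE; rewrite // sym ?far].
apply: (@embedding_has_induced _ _ f _ f_adj) => i j fij.
have row k : fork_adj i k = fork_adj j k.
  by rewrite -[fork_adj i k]f_adj fij f_adj.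
move: (row (@Ordinal 7 0 isT)) (row (@Ordinal 7 2 isT)) (row (@Ordinal 7 3 isT))
  (row (@Ordinal 7 4 isT)) (row (@Ordinal 7 1 isT)) fij => {row}.
case: i j => [[|[|[|[|[|[|[|//]]]]]]] ?] [[|[|[|[|[|[|[|//]]]]]]] ?] //;
  rewrite /fork_adj //= /f /= => _ _ _ _ _ gh'; try exact: val_inj;
  by rewrite ?gh' ?eqxx in gh.
Qed.

(** * Reduction to undominated graphs of minimum degree three *)

Definition nbrs (G : sgraph) (x : G) := [set y | adj x y].

Definition undominated (G : sgraph) :=
  forall u v : G, u != v -> exists w, adj u w && ~~ adj v w.

Lemma colorable_proper (G : sgraph) (k : nat) (c : G -> 'I_k) :
  (forall x y, adj x y -> c x != c y) -> colorable G k.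
Proof.
move=> cP; apply/existsP; exists [ffun x => c x].
by apply/forallP=> x; apply/forallP=> y; apply/implyP=> /cP; rewrite !ffunE.
Qed.

Lemma colorable_delete (G : sgraph) (u : G) (k : nat) :
  colorable (induced [set~ u]) k.+1 ->
  exists c : G -> 'I_k.+1,
    forall x y, x != u -> y != u -> adj x y -> c x != c y.
Proof.
move=> /existsP [c /forallP cP].
exists (fun x => oapp c ord0 (insub x)) => x y xu yu xy.
have xP : x \in [set~ u] by rewrite !inE.
have yP : y \in [set~ u] by rewrite !inE.
rewrite !insubT /=; move/forallP/(_ (Sub y yP))/implyP: (cP (Sub x xP)); apply.
by [].
Qed.

Lemma colorable_extend (G : sgraph) (u : G) (k : nat) (c : G -> 'I_k) (i : 'I_k) :
  (forall x y, x != u -> y != u -> adj x y -> c x != c y) ->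
  (forall y, adj u y -> c y != i) -> colorable G k.
Proof.
move=> cP ci; apply: (@colorable_proper _ _ (fun x => if x == u then i else c x)).
move=> x y; case: (altP (x =P u)) => [-> | xu]; case: (altP (y =P u)) => [-> | yu].
- by rewrite adj_irrefl.
- by move/ci; rewrite eq_sym.
- by rewrite adj_sym => /ci.
- exact: cP.
Qed.

(** A 3-colouring of [G] minus [u] extends to [u] if [u] has at most two neighbours, and
also if all neighbours of [u] are neighbours of some other vertex [v]: then [u] can
take the colour of [v]. *)
Lemma colorable3_reduction (P : sgraph -> Prop) :
  (forall (G : sgraph) (u : G), P G -> P (induced [set~ u])) ->
  (forall G : sgraph, P G -> undominated G -> (forall u : G, 2 < #|nbrs u|) ->
     colorable G 3) ->
  forall G : sgraph, P G -> colorable G 3.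
Proof.
move=> Pdel Pcore G; have [n] := ubnP #|G|; elim: n G => // n IHn G ltGn PG.
have del (u : G) : exists c : G -> 'I_3,
    forall x y, x != u -> y != u -> adj x y -> c x != c y.
  apply/colorable_delete/IHn/Pdel => //; rewrite card_sig.
  by rewrite cardsC1 -ltnS prednK //; apply/card_gt0P; exists u.
case: (boolP (colorable G 3)) => // ncol; rewrite -(negPf ncol).
apply: Pcore => // [u v uv | u].
  apply/existsP; apply: contraNT ncol; rewrite negb_exists => /forallP dom.
  have {}dom w : adj u w -> adj v w.
    by move=> uw; have := dom w; rewrite uw negbK.
  have [c cP] := del u; apply: (colorable_extend cP (i := c v)) => y uy.
  apply: cP; rewrite 1?eq_sym // 1?adj_sym; last exact: dom.
  by apply: contraTneq uy => ->; rewrite adj_irrefl.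
have [c cP] := del u; rewrite ltnNge; apply: contra ncol => degu.
have /subsetPn [i _ ci] : ~~ ([set: 'I_3] \subset c @: nbrs u).
  apply: contraTN degu => /subset_leq_card; rewrite cardsT card_ord -ltnNge => /leq_trans.
  by apply; apply: leq_imset_card.
apply: (colorable_extend cP (i := i)) => y uy.
by apply: contraNneq ci => <-; apply: imset_f; rewrite inE.
Qed.

(** * Maximum stable sets *)

Definition stable (G : sgraph) (S : {set G}) :=
  [forall x in S, forall y in S, ~~ adj x y].

Lemma stableP (G : sgraph) (S : {set G}) :
  reflect {in S &, forall x y, ~~ adj x y} (stable S).
Proof.
apply: (iffP 'forall_in_forall_inP) => [SP x y xS yS | SP x xS y yS]; exact: SP.
Qed.

Definition nbrs_in (G : sgraph) (S I : {set G}) :=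
  [set c in S | [exists x in I, adj x c]].

Definition light (G : sgraph) (S : {set G}) (x : G) :=
  (x \notin S) && (#|nbrs x :&: S| == 1).

Definition max_stable (G : sgraph) (S : {set G}) :=
  stable S /\ forall I : {set G}, stable I -> #|I| <= #|S|.

Section MaxStable.
Variables (G : sgraph) (S : {set G}).
Hypothesis Smax : max_stable S.

Lemma max_stable_adj : {in S &, forall x y, ~~ adj x y}.
Proof. by case: Smax => /stableP. Qed.

(** Otherwise exchanging the neighbours of [I] in [S] for [I] would enlarge [S]. *)
Lemma max_stable_hall (I : {set G}) :
  stable I -> [disjoint I & S] -> #|I| <= #|nbrs_in S I|.
Proof.
move=> /stableP stI dis; have [/stableP stS maxS] := Smax.
have /maxS : stable (I :|: (S :\: nbrs_in S I)).
  have cross x y : x \in I -> y \in S :\: nbrs_in S I -> ~~ adj x y.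
    move=> xI; rewrite !inE => /andP [+ yS]; apply: contra => xy.
    by rewrite yS; apply/existsP; exists x; rewrite xI.
  apply/stableP=> x y /setUP [xI | xS] /setUP [yI | yS].
  - exact: stI.
  - exact: cross.
  - by rewrite adj_sym; apply: cross.
  - by move: xS yS => /setDP [xS _] /setDP [yS _]; apply: stS.
have /eqP disI : I :&: (S :\: nbrs_in S I) == set0.
  by rewrite setIDA (eqP (_ : I :&: S == set0)) ?set0D // setI_eq0.
have subS : nbrs_in S I \subset S by apply/subsetP=> c; rewrite inE => /andP [].
rewrite cardsU disI cards0 subn0 cardsD (setIidPr subS) => le_card.
rewrite -(leq_add2r (#|S| - #|nbrs_in S I|)) subnKC //.
exact: subset_leq_card.
Qed.

Lemma max_stable_nbr x : x \notin S -> exists2 c, c \in S & adj x c.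
Proof.
move=> xS; have : 0 < #|nbrs_in S [set x]|.
  rewrite -(cards1 x); apply: max_stable_hall; last by rewrite disjoints1.
  by apply/stableP=> a b /set1P -> /set1P ->; rewrite adj_irrefl.
case/card_gt0P=> c; rewrite inE => /andP [cS /existsP [y /andP [/set1P -> yc]]].
by exists c.
Qed.

Lemma light_nbr x c d :
  light S x -> c \in S -> d \in S -> adj x c -> adj x d -> c = d.
Proof.
case/andP=> _ /cards1P [e def_e] cS dS xc xd.
have: c \in nbrs x :&: S by rewrite !inE xc.
have: d \in nbrs x :&: S by rewrite !inE xd.
by rewrite def_e => /set1P -> /set1P ->.
Qed.

Lemma heavy_nbr x c :
  x \notin S -> ~~ light S x -> exists d, [/\ d \in S, adj x d & d != c].
Proof.
move=> xS; rewrite /light xS /= => heavy; have [e eS xe] := max_stable_nbr xS.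
have [ec | ec] := altP (e =P c); last by exists e.
suff /existsP [d /and3P [dS xd dc]] : [exists d, [&& d \in S, adj x d & d != c]].
  by exists d.
apply: contraNT heavy; rewrite negb_exists => /forallP only_c.
apply/cards1P; exists c; apply/setP=> d; rewrite !inE.
apply/andP/eqP => [[xd dS] | ->]; last by rewrite -ec.
by have := only_c d; rewrite dS xd negbK => /eqP.
Qed.

(** Two vertices off [S] whose only neighbour in [S] is the same vertex could replace it;
they are not adjacent because they have a common neighbour. *)
Lemma light_inj x y c : triangle_free G ->
  light S x -> light S y -> c \in S -> adj x c -> adj y c -> x = y.
Proof.
move=> tf lx ly cS xc yc; apply/eqP; apply: contraT => xy.
have [/andP [xS _] /andP [yS _]] := (lx, ly).
have subc : nbrs_in S [set x; y] \subset [set c].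
  apply/subsetP=> d; rewrite !inE => /andP [dS /existsP [z /andP []]].
  by case/set2P=> -> zd; apply/eqP;
    [apply: light_nbr lx dS cS zd xc | apply: light_nbr ly dS cS zd yc].
have stxy : stable [set x; y].
  have xy' : ~~ adj x y by apply: tf xc _; rewrite adj_sym.
  apply/stableP=> a b /set2P [] -> /set2P [] ->; rewrite ?adj_irrefl //.
  by rewrite adj_sym.
have disxy : [disjoint [set x; y] & S].
  by apply/pred0P=> z /=; apply/negP=> /andP [/set2P [] ->]; apply/negP.
have := leq_trans (max_stable_hall stxy disxy) (subset_leq_card subc).
by rewrite cards2 xy cards1.
Qed.

End MaxStable.

(** * Odd closed walks and bipartite subgraphs *)

Section OddWalks.
Variable G : sgraph.
Implicit Types (X Y : {set G}) (x y z : G).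

(** Steps of the bipartite double cover of the subgraph induced on [X]. *)
Definition step_in X : rel (G * bool) :=
  fun a b => [&& adj a.1 b.1, a.1 \in X, b.1 \in X & b.2 == ~~ a.2].

(** The subgraph induced on [X] is not bipartite: a walk in the double cover between the
two copies of a vertex is an odd closed walk. *)
Definition odd_in X := [exists x in X, connect (step_in X) (x, true) (x, false)].

Lemma step_in_sym X : symmetric (step_in X).
Proof.
move=> [x b] [y c]; rewrite /step_in /= adj_sym.
by case: (adj y x) (x \in X) (y \in X) b c => [] [] [] [] [].
Qed.

Lemma connect_flip X x b y c :
  connect (step_in X) (x, b) (y, c) = connect (step_in X) (x, ~~ b) (y, ~~ c).
Proof.
have imp b' c' : connect (step_in X) (x, b') (y, c') ->
    connect (step_in X) (x, ~~ b') (y, ~~ c').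
  case/connectP=> p; elim: p x b' => [|[z d] p IHp] x' b' /=.
    by move=> _ [-> ->].
  case/andP=> step path_p last_p; apply: connect_trans (IHp _ _ path_p last_p).
  apply: connect1; move: step; rewrite /step_in /= => /and4P [-> -> -> /eqP ->].
  by rewrite eqxx.
by apply/idP/idP=> /imp; rewrite ?negbK.
Qed.

(** The two copies of a vertex of [X] lie in different components of the double cover, and
an edge exchanges these two components. *)
Lemma odd_in_coloring X : ~~ odd_in X ->
  exists c : G -> bool, {in X &, forall x y, adj x y -> c x != c y}.
Proof.
move=> no_odd.
have sym : connect_sym (step_in X) by apply: sym_connect_sym; apply: step_in_sym.
pose r x := root (step_in X) (x, true).
have no_turn x b : x \in X -> ~~ connect (step_in X) (x, b) (x, ~~ b).
  move=> xX; have : ~~ connect (step_in X) (x, true) (x, false).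
    by apply: contra no_odd => turn; apply/existsP; exists x; rewrite xX.
  by case: b => //=; rewrite connect_flip.
(* A vertex is coloured by which of its two copies has the smaller root. *)
exists (fun x => enum_rank (r x) < enum_rank (root (step_in X) (x, false))).
move=> x y xX yX xy.
have rootP b : root (step_in X) (x, b) = root (step_in X) (y, ~~ b).
  by apply/eqP; rewrite root_connect //; apply/connect1; rewrite /step_in /= xy xX yX eqxx.
rewrite /r !rootP /=; case: ltngtP => //; rewrite // => /val_inj/enum_rank_inj/eqP.
by rewrite root_connect // (negPf (no_turn y false yX)).
Qed.

Lemma coloring_not_odd X (c : G -> bool) :
  {in X &, forall x y, adj x y -> c x != c y} -> ~~ odd_in X.
Proof.
move=> cP; apply/negP => /exists_inP [x xX /connectP [p]].
have parity q a : path (step_in X) a q ->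
    (last a q).2 (+) c (last a q).1 = a.2 (+) c a.1.
  elim: q a => //= b q IHq a /andP [/and4P [ab aX bX /eqP eb]] /IHq ->.
  by rewrite eb; move: (cP _ _ aX bX ab); case: a.2 (c a.1) (c b.1) => [] [] [].
by move=> /parity + last_p; rewrite -last_p /=; case: (c x).
Qed.

Lemma odd_inS X Y : X \subset Y -> odd_in X -> odd_in Y.
Proof.
move=> sXY /exists_inP [x xX turn]; apply/exists_inP; exists x; first exact: (subsetP sXY).
apply: connect_sub turn => a b /and4P [ab aX bX eb]; apply: connect1.
by rewrite /step_in ab eb !(subsetP sXY).
Qed.

Lemma odd_in_walk X : odd_in X ->
  exists s : seq G, [/\ cycle (@adj G) s, odd (size s) & {subset s <= X}].
Proof.
case/exists_inP=> x xX /connectP [p step_p last_p].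
exists [seq a.1 | a <- p].
have walk q a : path (step_in X) a q ->
  [/\ path (@adj G) a.1 [seq b.1 | b <- q], (last a q).2 = odd (size q) (+) a.2
    & {subset [seq b.1 | b <- q] <= X}].
  elim: q a => //= b q IHq a /andP [/and4P [ab aX bX /eqP eb]] /IHq [-> -> sub].
  rewrite ab eb addNb addbN; split=> // y; rewrite inE => /predU1P [-> // | /sub //].
have [path_p odd_p sub_p] := walk _ _ step_p; split=> //.
  case: p path_p last_p {step_p odd_p sub_p} => //= b p /andP [xb path_p] last_p.
  by rewrite rcons_path path_p last_map -last_p.
by move: odd_p; rewrite size_map -last_p addbT; case: odd.
Qed.

End OddWalks.

(** * Shortest odd closed walks *)

Section ShortestOddWalk.
Variables (G : sgraph) (X : {set G}).

(** An odd closed walk is a periodic sequence of vertices; this makes all of its arcs,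
in particular those that pass through the starting point, images of intervals. *)
Record shortest_odd_walk (n : nat) (c : nat -> G) : Prop := ShortestOddWalk {
  sow_odd : odd n;
  sow_in : forall i, c i \in X;
  sow_period : forall i, c (i + n) = c i;
  sow_adj : forall i, adj (c i) (c i.+1);
  sow_min : forall s : seq G,
    cycle (@adj G) s -> odd (size s) -> {subset s <= X} -> n <= size s
}.

Lemma shortest_odd_walk_exists : odd_in X -> exists n c, shortest_odd_walk n c.
Proof.
pose P n := [exists t : n.-tuple G, [&& cycle (@adj G) t, odd n & all [in X] t]].
have PP s : cycle (@adj G) s -> odd (size s) -> {subset s <= X} -> P (size s).
  move=> cyc_s odd_s sub_s; apply/existsP; exists (in_tuple s).
  by rewrite cyc_s odd_s; apply/allP.
case/odd_in_walk=> s0 [cyc0 odd0 sub0].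
have [n /existsP [t /and3P [cyc_t odd_t /allP sub_t]] min_n] :=
  @ex_minnP P (ex_intro P _ (PP s0 cyc0 odd0 sub0)).
have [x0 def_t] : exists x0, tnth t (Ordinal (odd_gt0 odd_t)) = x0 by eexists.
have n_gt0 := odd_gt0 odd_t; pose c i := nth x0 t (i %% n).
have cX i : c i \in X by apply/sub_t/mem_nth; rewrite size_tuple ltn_pmod.
exists n, c; split=> // [i | i | s cyc_s odd_s sub_s].
- by rewrite /c modnDr.
- have [x [s def_s]] : exists x s, tval t = x :: s.
    by case: (tval t) (size_tuple t) n_gt0 => [<- // | x s _ _]; exists x, s.
  have sz_s : (size s).+1 = n by rewrite -(size_tuple t) def_s.
  move: cyc_t; rewrite def_s /= => /(pathP x0) /(_ (i %% n)).
  rewrite size_rcons sz_s ltn_pmod // => /(_ isT).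
  rewrite -rcons_cons nth_rcons /= sz_s ltn_pmod // /c def_s.
  have -> : i.+1 = i %/ n * n + (i %% n).+1 by rewrite addnS -divn_eq.
  rewrite modnMDl nth_rcons; have := ltn_pmod i n_gt0.
  rewrite -sz_s ltnS leq_eqVlt => /predU1P [-> | lt_i].
    by rewrite ltnn eqxx modnn.
  by rewrite lt_i [_.+1 %% _]modn_small.
- exact/min_n/PP.
Qed.

Variables (n : nat) (c : nat -> G).
Hypothesis cP : shortest_odd_walk n c.

Lemma walk_wrap i m : c (i + m * n) = c i.
Proof.
elim: m => [|m IHm]; first by rewrite addn0.
by rewrite mulSn addnCA addnC (sow_period cP).
Qed.

Lemma on_walkP z : (exists j, z = c j) \/ forall j, z != c j.
Proof.
have [/existsP [j /eqP ->] | none] := boolP [exists j : 'I_n, z == c j].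
  by left; exists j.
right=> j; apply: contra none => /eqP ->; apply/existsP.
have j_lt : j %% n < n by rewrite ltn_pmod // (odd_gt0 (sow_odd cP)).
by exists (Ordinal j_lt); rewrite /= {1}(divn_eq j n) addnC walk_wrap.
Qed.

Lemma arc_path i a : path (@adj G) (c i) [seq c j | j <- iota i.+1 a].
Proof. by elim: a i => //= a IHa i; rewrite (sow_adj cP) IHa. Qed.

Lemma last_arc i a : last (c i) [seq c j | j <- iota i.+1 a] = c (i + a).
Proof. by elim: a i => [|a IHa] i /=; rewrite ?addn0 // IHa addSnnS. Qed.

Lemma arc_in i a : {subset [seq c j | j <- iota i a] <= X}.
Proof. by move=> _ /mapP [j _ ->]; apply: (sow_in cP). Qed.

(** A vertex joined to both ends of an odd arc closes it to an odd walk. *)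
Lemma odd_arc_detour z i a : z \in X -> adj z (c i) -> adj z (c (i + a)) ->
  odd a -> n <= a.+2.
Proof.
move=> zX zi za odd_a; pose s := z :: [seq c j | j <- iota i a.+1].
have <- : size s = a.+2 by rewrite /= size_map size_iota.
apply: (sow_min cP).
- by rewrite /= zi rcons_path arc_path last_arc adj_sym.
- by rewrite /= size_map size_iota odd_a.
- by move=> y; rewrite inE => /predU1P [-> // |]; apply: arc_in.
Qed.

Lemma walk_even_complement a : a < n -> ~~ odd a -> odd (n - a).
Proof. by move=> lt_a even_a; rewrite oddB ?(ltnW lt_a) // (sow_odd cP) addTb. Qed.

(** The two arcs between [c i] and [c (i + a)] have different parities, and the odd one
closes through [z] to an odd walk of length at least [n]; so the other arc has length
two. *)
Lemma chord_length z i a : z \in X -> 0 < a < n ->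
  adj z (c i) -> adj z (c (i + a)) -> a = 2 \/ a.+2 = n.
Proof.
move=> zX /andP [a_gt0 a_lt] zi za; case: (boolP (odd a)) => [odd_a | even_a].
  right; apply/eqP; rewrite eqn_leq (odd_arc_detour zX zi za odd_a) andbT.
  rewrite ltn_neqAle a_lt andbT; apply: contraTneq (sow_odd cP) => <-.
  by rewrite /= odd_a.
left; have odd_b := walk_even_complement a_lt even_a.
have := odd_arc_detour zX za (a := n - a); rewrite -addnA subnKC ?(ltnW a_lt) //.
rewrite (sow_period cP) => /(_ zi odd_b) le_n.
have {le_n a_lt} : a <= 2 by lia.
by case: a a_gt0 even_a {zi za odd_b} => [|[|[|]]].
Qed.

(** A repetition would split the walk into two closed walks, one of them odd. *)
Lemma walk_inj i a : 0 < a < n -> c i != c (i + a).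
Proof.
have closed j b : 0 < b -> odd b -> c j = c (j + b) -> n <= b.
  case: b => // b _ odd_b cjb; pose s := [seq c k | k <- iota j b.+1].
  have <- : size s = b.+1 by rewrite size_map size_iota.
  apply: (sow_min cP); last exact: arc_in.
    by rewrite /= rcons_path arc_path last_arc cjb addnS (sow_adj cP).
  by rewrite size_map size_iota.
move=> /andP [a_gt0 a_lt]; apply/eqP => cia.
case: (boolP (odd a)) => [odd_a | even_a]; first by have := closed i a a_gt0 odd_a cia; lia.
have := closed (i + a) (n - a); rewrite -addnA subnKC ?(ltnW a_lt) //.
rewrite (sow_period cP) -cia subn_gt0 a_lt (walk_even_complement a_lt even_a).
by move=> /(_ isT isT erefl); lia.
Qed.

Lemma walk_length : triangle_free G -> 4 < n.
Proof.
move=> tf; have := sow_odd cP; case def_n: n => [|[|[|[|[|]]]]] //= _.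
  by have := sow_adj cP 0; rewrite -(sow_period cP 0) def_n addn1 adj_irrefl.
have /negP[] := tf _ _ _ (sow_adj cP 0) (sow_adj cP 1).
by rewrite -(sow_period cP 0) def_n adj_sym; apply: (sow_adj cP).
Qed.

(** A chord at [c i] and the edges to its two neighbours on the walk give arcs to which
[chord_length] applies; it leaves no chord because [n] is odd and larger than four. *)
Lemma walk_chordless i a : triangle_free G -> 0 < a < n ->
  adj (c i) (c (i + a)) -> a = 1 \/ a.+1 = n.
Proof.
move=> tf a_lt ia; have n_gt := walk_length tf.
have [a1 | a_gt1] : a = 1 \/ 1 < a by lia.
  by left.
have next := sow_adj cP i.
have prev : adj (c i) (c (i + (n - 1))).
  rewrite adj_sym; have := sow_adj cP (i + (n - 1)).
  by rewrite (_ : (i + (n - 1)).+1 = i + n) ?(sow_period cP) //; lia.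
have cX := sow_in cP i.
have := @chord_length (c i) i.+1 (a - 1) cX; rewrite next addSn -addnS.
rewrite (_ : (a - 1).+1 = a); last by lia.
case=> // [|a3|]; [by lia | | by lia].
have [an | a_lt'] : a = n - 1 \/ a < n - 1 by lia.
  by right; lia.
have := @chord_length (c i) (i + a) (n - 1 - a) cX; rewrite ia -addnA.
rewrite (_ : a + (n - 1 - a) = n - 1); last by lia.
rewrite prev; case=> // [|b2|]; [by lia | | by lia].
by have := sow_odd cP; rewrite (_ : n = 6) //; lia.
Qed.

End ShortestOddWalk.

(** * A tableau calculus for local configurations *)

(** A tableau is a partial description of an induced subgraph with vertices
[0, ..., size inS - 1]: which of them lie in [S], known adjacencies and non-adjacencies
as lists indexed by the vertices, and vertices known to be light or heavy.  A pair in
[barred] has no common neighbour off [S], and for a pair [(i, j)] in [forced] every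
neighbour of [i] in [S] is a neighbour of [j]. *)
Record tableau := Tableau {
  inS : seq bool;
  edges : seq (seq nat);
  nonedges : seq (seq nat);
  lights : seq nat;
  heavies : seq nat;
  barred : seq (nat * nat);
  forced : seq (nat * nat)
}.

(** The case distinctions.  [OnUndominated u v] asks for a neighbour of [u] that is not one
of [v].  [OnNbr h] asks for a neighbour of [h] in [S] that is not yet known to be one,
when [h] is heavy and has at most one known neighbour or when it has none.  [OnHall hs]
asks for a new neighbour in [S] of one of the vertices of a stable set which has fewer
known neighbours than elements. *)
Inductive query :=
| OnPair of nat & nat
| OnLight of nat
| OnUndominated of nat & nat
| OnNbr of nat
| OnHall of seq nat.

(** [Fork f] closes a branch in which [f] is an induced fork.  [Derive f r] uses a fork that
is complete up to a single adjacency: that adjacency is settled the other way. *)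
Inductive refutation :=
| Fork of seq nat
| Clash of nat & nat
| Derive of seq nat & refutation
| Ask of query & seq refutation.

Lemma mem_iota0 n i : (i \in iota 0 n) = (i < n).
Proof. by rewrite mem_iota add0n. Qed.

Definition row (r : seq (seq nat)) u := nth [::] r u.
Definition insert (r : seq (seq nat)) u v := set_nth [::] r u (v :: row r u).
Definition insert2 r u v := insert (insert r u v) v u.

Lemma mem_insert2 r u v a b :
  b \in row (insert2 r u v) a ->
  [\/ a = u /\ b = v, a = v /\ b = u | b \in row r a].
Proof.
rewrite /insert2 /insert /row nth_set_nth /=; case: eqP => [-> | _].
  rewrite inE => /predU1P [-> | ]; first by constructor 2.
  rewrite nth_set_nth /=; case: eqP => [-> | _]; last by constructor 3.
  by rewrite inE => /predU1P [-> | ]; [constructor 1 | constructor 3].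
rewrite nth_set_nth /=; case: eqP => [-> | _]; last by constructor 3.
by rewrite inE => /predU1P [-> | ]; [constructor 1 | constructor 3].
Qed.

Section Rules.
Variable t : tableau.

Definition nverts := size (inS t).
Definition in_S u := nth false (inS t) u.
Definition in_H u := (u < nverts) && ~~ in_S u.
Definition is_edge u v := v \in row (edges t) u.
Definition S_row u := [seq c <- row (edges t) u | in_S c].

(** A light [h] is not adjacent to [d] in [S] when it already has another neighbour in [S],
or when [d] is the neighbour of another light vertex. *)
Definition light_bars h d :=
  [&& h \in lights t, in_S d &
     has (fun c => in_S c && (c != d)) (row (edges t) h) ||
     has (fun g => (g \in lights t) && (g != h)) (row (edges t) d)].

Definition pair_bars z j :=
  in_H z && has (fun b => (b.2 == j) && is_edge z b.1) (barred t).

(** Besides the recorded non-edges: a common neighbour would close a triangle, [S] is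
stable, and the rules for light vertices and barred pairs. *)
Definition is_nonedge u v :=
  [|| v \in row (nonedges t) u, has (is_edge v) (row (edges t) u),
      in_S u && in_S v, light_bars u v, light_bars v u, pair_bars u v |
      pair_bars v u].

Definition forced_from u v :=
  if in_S u then [seq (u, b.2) | b <- forced t & b.1 == v] else [::].

Definition add_edge u v :=
  Tableau (inS t)
    (foldl (fun r e => insert2 r e.1 e.2) (edges t)
       ((u, v) :: forced_from u v ++ forced_from v u))
    (nonedges t) (lights t) (heavies t) (barred t) (forced t).
Definition add_nonedge u v :=
  Tableau (inS t) (edges t) (insert2 (nonedges t) u v) (lights t) (heavies t)
    (barred t) (forced t).
Definition add_light u :=
  Tableau (inS t) (edges t) (nonedges t) (u :: lights t) (heavies t) (barred t)
    (forced t).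
Definition add_heavy u :=
  Tableau (inS t) (edges t) (nonedges t) (lights t) (u :: heavies t) (barred t)
    (forced t).
Definition add_vertex b :=
  Tableau (rcons (inS t) b) (edges t) (nonedges t) (lights t) (heavies t)
    (barred t) (forced t).

(** The edges (marked [true]) and non-edges (marked [false]) that are not yet known among
those that make [f] an induced fork. *)
Definition missing (f : seq nat) : option (seq (bool * (nat * nat))) :=
  if f is [:: v; p; x; q; y; g; h] then
    if (g != h) && all (fun i => i < nverts) f then
      Some ([seq (true, e) | e <- zip [:: v; p; v; q; v; v] [:: p; x; q; y; g; h]
                           & ~~ is_edge e.1 e.2] ++
            [seq (false, e) | e <- zip [:: x; x; x; x; y; y; y] [:: q; y; g; h; p; g; h]
                           & ~~ is_nonedge e.1 e.2])
    else None
  else None.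

End Rules.

Definition add_nonedges (t : tableau) (ps : seq (nat * nat)) :=
  foldl (fun t p => add_nonedge t p.1 p.2) t ps.

(** An answer to a query that asks for a vertex is either found in the tableau or is a new
vertex.  In the latter case no vertex of the tableau is an answer, and this is recorded
as well: it settles the second adjacency of every vertex for which one of the two
adjacencies that would make it an answer is known. *)
Definition branches (t : tableau) (r : query) : option (seq tableau) :=
  let n := nverts t in
  match r with
  | OnPair u v =>
    if (u < n) && (v < n) then Some [:: add_edge t u v; add_nonedge t u v]
    else None
  | OnLight h =>
    if in_H t h then Some [:: add_light t h; add_heavy t h] else None
  | OnUndominated u v =>
    if [&& u != v, u < n & v < n] then
      let ws := [seq w <- iota 0 n |
        ~~ [|| w == u, is_nonedge t w u | is_edge t w v]] in
      let t' := foldl (fun t' w =>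
        if is_edge t w u then add_edge t' w v else
        if is_nonedge t w v then add_nonedge t' w u else t') t ws in
      Some ([seq add_nonedge (add_edge t w u) w v | w <- ws] ++
            [seq add_nonedge (add_edge (add_vertex t' b) n u) n v |
               b <- if in_S t u then [:: false] else [:: true; false]])
    else None
  | OnNbr h =>
    let known := S_row t h in
    if in_H t h && (if known is c :: cs then all (pred1 c) cs && (h \in heavies t)
                    else true) then
      let cs := [seq c <- iota 0 n |
        [&& in_S t c, c \notin known & ~~ is_nonedge t h c]] in
      Some ([seq add_edge t h c | c <- cs] ++
        [:: add_edge (add_vertex (add_nonedges t [seq (h, c) | c <- cs]) true) h n])
    else None
  | OnHall hs =>
    let known := flatten [seq S_row t h | h <- hs] in
    if [&& uniq hs, all (in_H t) hs,
           all (fun a => all (fun b => (a == b) || is_nonedge t a b) hs) hs &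
           size (undup known) < size hs] then
      let ps := [seq (h, c) | h <- hs, c <- [seq c <- iota 0 n |
        [&& in_S t c, c \notin known & ~~ is_nonedge t h c]]] in
      Some ([seq add_edge t p.1 p.2 | p <- ps] ++
        [seq add_edge (add_vertex (add_nonedges t ps) true) h n | h <- hs])
    else None
  end.

Fixpoint refutes (t : tableau) (r : refutation) : bool :=
  match r with
  | Fork f => if missing t f is Some [::] then true else false
  | Clash u v => is_edge t u v && ((u == v) || is_nonedge t u v)
  | Derive f r' =>
    match missing t f with
    | Some [:: (true, (u, v))] => refutes (add_nonedge t u v) r'
    | Some [:: (false, (u, v))] => refutes (add_edge t u v) r'
    | _ => false
    end
  | Ask s rs =>
    if branches t s is Some ts then
      (fix all_refuted ts rs {struct rs} := match ts, rs with
       | [::], [::] => true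
       | t' :: ts', r' :: rs' => refutes t' r' && all_refuted ts' rs'
       | _, _ => false
       end) ts rs
    else false
  end.

Section Soundness.
Variables (G : sgraph) (S : {set G}).
Hypothesis tf : triangle_free G.
Hypothesis ff : fork_free G.
Hypothesis und : undominated G.
Hypothesis Smax : max_stable S.

Record realizes (rho : nat -> G) (t : tableau) : Prop := Realizes {
  rz_inj : forall i j, i < nverts t -> j < nverts t -> rho i = rho j -> i = j;
  rz_inS : forall i, i < nverts t -> in_S t i = (rho i \in S);
  rz_edge : forall u v, is_edge t u v ->
    [/\ u < nverts t, v < nverts t & adj (rho u) (rho v)];
  rz_nonedge : forall u v, v \in row (nonedges t) u ->
    [/\ u < nverts t, v < nverts t & ~~ adj (rho u) (rho v)];
  rz_light : forall u, u \in lights t -> u < nverts t /\ light S (rho u);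
  rz_heavy : forall u, u \in heavies t -> u < nverts t /\ ~~ light S (rho u);
  rz_barred : forall i j, (i, j) \in barred t -> [/\ i < nverts t, j < nverts t &
    forall z, z \notin S -> adj z (rho i) -> ~~ adj z (rho j)];
  rz_forced : forall i j, (i, j) \in forced t -> [/\ i < nverts t, j < nverts t &
    forall s, s \in S -> adj s (rho i) -> adj s (rho j)]
}.

Definition realizable t := exists rho, realizes rho t.

Lemma in_S_lt t u : in_S t u -> u < nverts t.
Proof. by apply: contraTltn => le_u; rewrite /in_S nth_default. Qed.

Lemma nverts_add_vertex t b : nverts (add_vertex t b) = (nverts t).+1.
Proof. exact: size_rcons. Qed.

Lemma in_S_add_vertex t b i :
  in_S (add_vertex t b) i = if i == nverts t then b else in_S t i.
Proof.
rewrite /in_S /= nth_rcons -/(nverts t); case: ltngtP => // i_gt.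
by rewrite nth_default // ltnW.
Qed.

Section Facts.
Variables (rho : nat -> G) (t : tableau).
Hypothesis rt : realizes rho t.

Lemma in_SP u : in_S t u -> rho u \in S.
Proof. by move=> uS; rewrite -(rz_inS rt) // in_S_lt. Qed.

Lemma in_HP u : in_H t u -> rho u \notin S.
Proof. by case/andP=> u_lt; rewrite (rz_inS rt). Qed.

Lemma light_barsP h d : light_bars t h d -> ~~ adj (rho h) (rho d).
Proof.
case/and3P=> hL dS; have [h_lt hlight] := rz_light rt hL; apply: contraTN => hd.
have rhodS := in_SP dS; rewrite negb_or; apply/andP; split; apply/hasPn.
  move=> c hc; have [_ c_lt adj_hc] := rz_edge rt hc.
  apply/negP=> /andP [cS /negP []]; apply/eqP.
  apply: (rz_inj rt) (in_S_lt dS) _ => //.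
  exact: light_nbr hlight (in_SP cS) rhodS adj_hc hd.
move=> g dg; have [_ g_lt adj_dg] := rz_edge rt dg.
apply/negP=> /andP [gL /negP []]; apply/eqP; have [_ glight] := rz_light rt gL.
apply: (rz_inj rt) => //; rewrite adj_sym in adj_dg.
exact: light_inj glight hlight rhodS adj_dg hd.
Qed.

Lemma pair_barsP z j : pair_bars t z j -> ~~ adj (rho z) (rho j).
Proof.
case/andP=> zH /hasP [[i j'] /= ij /andP [/eqP <- zi]].
have [_ _ adj_zi] := rz_edge rt zi; have [_ _ bar] := rz_barred rt ij.
exact: bar (in_HP zH) adj_zi.
Qed.

Lemma is_nonedgeP u v : is_nonedge t u v -> ~~ adj (rho u) (rho v).
Proof.
rewrite /is_nonedge; case/or4P=> [/(rz_nonedge rt) [] // | /hasP [w uw vw] | |].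
- have [_ _ adj_uw] := rz_edge rt uw; have [_ _ adj_vw] := rz_edge rt vw.
  by apply: tf adj_uw _; rewrite adj_sym.
- by case/andP=> uS vS; apply: (max_stable_adj Smax); apply: in_SP.
case/or4P; first exact: light_barsP.
- by rewrite adj_sym; apply: light_barsP.
- exact: pair_barsP.
- by rewrite adj_sym; apply: pair_barsP.
Qed.

Lemma forced_fromP u v e : u < nverts t -> adj (rho u) (rho v) ->
  e \in forced_from t u v ->
  [/\ e.1 < nverts t, e.2 < nverts t & adj (rho e.1) (rho e.2)].
Proof.
move=> u_lt uv; rewrite /forced_from; case: ifP => // uS.
case/mapP=> -[i j]; rewrite mem_filter => /andP [/= /eqP ->].
case/(rz_forced rt)=> _ j_lt force ->; split=> //; exact: force (in_SP uS) uv.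
Qed.

Lemma realizes_add_edge u v : u < nverts t -> v < nverts t ->
  adj (rho u) (rho v) -> realizes rho (add_edge t u v).
Proof.
move=> u_lt v_lt uv; case: (rt) => rinj rS re rn rl rh rb rf; split=> // a b.
rewrite /is_edge /add_edge /=; move: (insert2 _ u v) (fun a b => @mem_insert2 (edges t) u v a b).
move=> r0 r0P.
have {r0P} : forall a b, b \in row r0 a ->
    [/\ a < nverts t, b < nverts t & adj (rho a) (rho b)].
  move=> a' b'; case/r0P=> [[-> ->] | [-> ->] | /re]; rewrite // adj_sym.
  by split.
have : forall e, e \in forced_from t u v ++ forced_from t v u ->
    [/\ e.1 < nverts t, e.2 < nverts t & adj (rho e.1) (rho e.2)].
  move=> e; rewrite mem_cat => /orP [] /forced_fromP; apply=> //.
  by rewrite adj_sym.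
elim: (_ ++ _) r0 => [|[u' v'] es IHes] r0 esP r0P /=; first exact: r0P.
apply: IHes => [e e_es | a' b']; first by apply: esP; rewrite inE e_es orbT.
have /= [u'_lt v'_lt uv'] := esP (u', v') (mem_head _ _).
case/mem_insert2=> [[-> ->] | [-> ->] | /r0P]; rewrite // adj_sym.
by split.
Qed.

Lemma realizes_add_nonedge u v : u < nverts t -> v < nverts t ->
  ~~ adj (rho u) (rho v) -> realizes rho (add_nonedge t u v).
Proof.
move=> u_lt v_lt uv; case: rt => rinj rS re rn rl rh rb rf; split=> // a b.
by case/mem_insert2=> [[-> ->] | [-> ->] | /rn]; rewrite // adj_sym.
Qed.

Lemma realizes_add_light u : u < nverts t -> light S (rho u) ->
  realizes rho (add_light t u).
Proof.
move=> u_lt uL; case: rt => rinj rS re rn rl rh rb rf; split=> // a.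
by rewrite inE => /predU1P [-> | /rl].
Qed.

Lemma realizes_add_heavy u : u < nverts t -> ~~ light S (rho u) ->
  realizes rho (add_heavy t u).
Proof.
move=> u_lt uL; case: rt => rinj rS re rn rl rh rb rf; split=> // a.
by rewrite inE => /predU1P [-> | /rh].
Qed.

Lemma realizes_add_vertex w : (forall i, i < nverts t -> rho i != w) ->
  realizes (fun i => if i == nverts t then w else rho i)
    (add_vertex t (w \in S)).
Proof.
move=> fresh; case: rt => rinj rS re rn rl rh rb rf.
have old i : i < nverts t -> (i == nverts t) = false by move/ltn_eqF.
have lt_new i : i < nverts t -> i < (nverts t).+1 by apply: ltnW.
split; rewrite ?nverts_add_vertex.
- move=> i j; rewrite !ltnS leq_eqVlt (leq_eqVlt j).
  case: eqP => [-> | _] /=; case: eqP => [-> | _] //= i_lt j_lt.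
  + by move/esym/eqP; rewrite (negPf (fresh _ _)).
  + by move/eqP; rewrite (negPf (fresh _ _)).
  + exact: rinj.
- move=> i; rewrite ltnS leq_eqVlt in_S_add_vertex.
  by case: eqP => //= _ i_lt; apply: rS.
- by move=> u v /re [u_lt v_lt]; rewrite !old ?lt_new.
- by move=> u v /rn [u_lt v_lt]; rewrite !old ?lt_new.
- by move=> u /rl [u_lt]; rewrite old ?lt_new.
- by move=> u /rh [u_lt]; rewrite old ?lt_new.
- by move=> i j /rb [i_lt j_lt]; rewrite !old ?lt_new.
- by move=> i j /rf [i_lt j_lt]; rewrite !old ?lt_new.
Qed.

Lemma missingP f m : missing t f = Some m ->
  (forall e, e \in m -> e.2.1 < nverts t /\ e.2.2 < nverts t) /\
  exists2 e, e \in m & e.1 != adj (rho e.2.1) (rho e.2.2).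
Proof.
case: f => [|v [|p [|x [|q [|y [|g [|h [|]]]]]]]] //=; case: ifP => //.
rewrite !andbT.
case/andP=> gh /and5P [vn pn xn qn /and3P [yn gn hn]] [def_m].
set es := [:: (v, p); (p, x); (v, q); (q, y); (v, g); (v, h)].
set ns := [:: (x, q); (x, y); (x, g); (x, h); (y, p); (y, g); (y, h)].
have {}def_m : m = [seq (true, e) | e <- es & ~~ is_edge t e.1 e.2] ++
    [seq (false, e) | e <- ns & ~~ is_nonedge t e.1 e.2] by rewrite -def_m.
have bound : all (fun e => (e.1 < nverts t) && (e.2 < nverts t)) (es ++ ns).
  by rewrite /= vn pn xn qn yn gn hn.
split.
  move=> e; rewrite def_m mem_cat => em.
  suff /(allP bound)/andP : e.2 \in es ++ ns by [].
  by rewrite mem_cat; case/orP: em => /mapP [e' + ->];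
    rewrite mem_filter => /andP [_ ->]; rewrite ?orbT.
apply/hasP; apply: contraT => /hasPn agree.
have edgeP e : e \in es -> adj (rho e.1) (rho e.2).
  move=> e_es; case: (boolP (is_edge t e.1 e.2)) => [/(rz_edge rt) [] // | ne].
  have /agree : (true, e) \in m.
    by rewrite def_m mem_cat map_f // mem_filter ne.
  by rewrite negbK => /eqP <-.
have nonedgeP e : e \in ns -> ~~ adj (rho e.1) (rho e.2).
  move=> e_ns; case: (boolP (is_nonedge t e.1 e.2)) => [/is_nonedgeP // | ne].
  have /agree : (false, e) \in m.
    by rewrite def_m mem_cat [X in _ || X]map_f ?orbT // mem_filter ne.
  by rewrite negbK => /eqP <-.
have rgh : rho g != rho h.
  by apply: contraNneq gh => /(rz_inj rt gn hn) ->.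
have := @ff (rho v) (rho p) (rho x) (rho q) (rho y) (rho g) (rho h) rgh.
have : all (fun e => adj (rho e.1) (rho e.2)) es by apply/allP.
have : all (fun e => ~~ adj (rho e.1) (rho e.2)) ns by apply/allP.
rewrite /= !andbT => /and5P [-> -> -> -> /and3P [-> -> ->]].
by case/and5P=> -> -> -> -> /andP [-> ->] /(_ isT).
Qed.

End Facts.

Lemma realizes_add_nonedges rho t ps : realizes rho t ->
  all (fun p => [&& p.1 < nverts t, p.2 < nverts t & ~~ adj (rho p.1) (rho p.2)]) ps ->
  realizes rho (add_nonedges t ps) /\ nverts (add_nonedges t ps) = nverts t.
Proof.
elim: ps t => //= -[u v] ps IHps t rt /andP [/and3P [/= u_lt v_lt uv] ps_ok].
exact: IHps (realizes_add_nonedge rt u_lt v_lt uv) ps_ok.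
Qed.

Lemma realizable_new_nbr rho t ps h d : realizes rho t ->
  all (fun p => [&& p.1 < nverts t, p.2 < nverts t & ~~ adj (rho p.1) (rho p.2)]) ps ->
  h < nverts t -> d \in S -> adj (rho h) d -> (forall i, i < nverts t -> rho i != d) ->
  realizable (add_edge (add_vertex (add_nonedges t ps) true) h (nverts t)).
Proof.
move=> rt ps_ok h_lt dS hd fresh; have [rt' on] := realizes_add_nonedges rt ps_ok.
rewrite -on in h_lt fresh *; have := realizes_add_vertex rt' fresh.
rewrite dS => rt''; exists (fun i => if i == nverts (add_nonedges t ps) then d else rho i).
apply: realizes_add_edge => //; rewrite ?nverts_add_vertex ?ltnS //; first exact: ltnW.
by rewrite eqxx ltn_eqF.
Qed.

Fixpoint some_realizable (ts : seq tableau) : Prop :=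
  if ts is t :: ts' then realizable t \/ some_realizable ts' else False.

Lemma some_realizable_cat ts1 ts2 :
  some_realizable ts1 \/ some_realizable ts2 -> some_realizable (ts1 ++ ts2).
Proof. by elim: ts1 => /= [|t ts1 IHts] []; tauto. Qed.

Lemma some_realizable_map (T : eqType) (f : T -> tableau) (xs : seq T) x :
  x \in xs -> realizable (f x) -> some_realizable [seq f x | x <- xs].
Proof.
elim: xs => //= y xs IHxs; rewrite inE => /predU1P [<- | x_xs] rx; first by left.
by right; apply: IHxs.
Qed.

(** For the queries that ask for a vertex, an answer exists in the graph.  Either it is already
a vertex of the tableau, or it extends [rho] to one more vertex; in that case none of the old
vertices is an answer, so the facts recorded about them hold. *)
Lemma branchesP rho t s ts : realizes rho t -> branches t s = Some ts ->
  some_realizable ts.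
Proof.
move=> rt; case: s => /= [u v | h | u v | h | hs].
- case: ifP => // /andP [u_lt v_lt] [<-]; case: (boolP (adj (rho u) (rho v))) => uv.
    by left; exists rho; apply: realizes_add_edge.
  by right; left; exists rho; apply: realizes_add_nonedge.
- case: ifP => // /andP [h_lt _] [<-]; case: (boolP (light S (rho h))) => hL.
    by left; exists rho; apply: realizes_add_light.
  by right; left; exists rho; apply: realizes_add_heavy.
- case: ifP => // /and3P [uv u_lt v_lt]; set ws := [seq w <- _ | _].
  set t' := foldl _ _ _ => -[<-]; apply: some_realizable_cat.
  have nuv : rho u != rho v by apply: contraNneq uv => /(rz_inj rt) ->.
  have [w /andP [uw vw]] := und nuv.
  pose wit i := adj (rho i) (rho u) && ~~ adj (rho i) (rho v).
  have ws_lt i : i \in ws -> i < nverts t by rewrite mem_filter mem_iota0 => /andP [].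
  have [/hasP [i i_lt /andP [iu iv]] | /hasPn no_wit] := boolP (has wit (iota 0 (nverts t))).
    left; rewrite mem_iota0 in i_lt; apply: (some_realizable_map (x := i)).
      rewrite mem_filter mem_iota0 i_lt andbT; apply/norP; split; last (apply/norP; split).
      - by apply: contraTneq iu => ->; rewrite adj_irrefl.
      - by apply: contraTN iu => /(is_nonedgeP rt).
      - by apply: contraNN iv => /(rz_edge rt) [].
    by exists rho; apply: realizes_add_nonedge => //; apply: realizes_add_edge.
  right.
  have fresh i : i < nverts t -> rho i != w.
    move=> i_lt; have := no_wit i; rewrite mem_iota0 => /(_ i_lt).
    by apply: contraNneq => iw; rewrite /wit iw [adj w (rho u)]adj_sym uw adj_sym vw.
  have [rt' on] : realizes rho t' /\ nverts t' = nverts t.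
    rewrite /t'; set F := fun _ _ => _.
    have fold_ok l t0 : {in l, forall j, j < nverts t} -> realizes rho t0 ->
        nverts t0 = nverts t -> realizes rho (foldl F t0 l) /\ nverts (foldl F t0 l) = nverts t.
      elim: l t0 => //= i l IHl t0 l_lt rt0 on0.
      have := no_wit i; rewrite mem_iota0 l_lt ?mem_head // => /(_ isT) no_i.
      have i_lt := l_lt i (mem_head _ _).
      have {}l_lt : {in l, forall j, j < nverts t}.
        by move=> j j_l; apply: l_lt; rewrite inE j_l orbT.
      rewrite {2 4}/F; case: ifP => [/(rz_edge rt) [_ _ iu] | _].
        apply: IHl => //; apply: realizes_add_edge; rewrite ?on0 //.
        by move: no_i; rewrite /wit iu negbK.
      case: ifP => [/(is_nonedgeP rt) iv | _]; last exact: IHl.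
      apply: IHl => //; apply: realizes_add_nonedge; rewrite ?on0 //.
      by move: no_i; rewrite /wit iv andbT.
    exact: fold_ok.
  have wS : in_S t u -> w \in S = false.
    move=> uS; apply: contraTF uw => wS.
    exact: (max_stable_adj Smax) (in_SP rt uS) wS.
  rewrite -on in fresh u_lt v_lt *.
  apply: (some_realizable_map (x := w \in S)).
    by case: ifP => [/wS -> | _]; rewrite ?inE //; case: (w \in S).
  have := realizes_add_vertex rt' fresh; set rho' := fun i => _ => rt''.
  have lt_new i : i < nverts t' -> i < nverts (add_vertex t' (w \in S)).
    by rewrite nverts_add_vertex => /ltnW.
  have n_new : nverts t' < nverts (add_vertex t' (w \in S)).
    by rewrite nverts_add_vertex.
  exists rho'; apply: realizes_add_nonedge => //; last 1 first.
  - by rewrite /rho' eqxx ltn_eqF // adj_sym.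
  - apply: realizes_add_edge => //; first exact: lt_new.
    by rewrite /rho' eqxx ltn_eqF // adj_sym.
  - exact: lt_new.
- case: ifP => // /andP [hH hknown] [<-]; set cs := [seq c <- _ | _].
  have hS := in_HP rt hH; have h_lt : h < nverts t by case/andP: hH.
  have known_S c : c \in S_row t h -> c < nverts t /\ rho c \in S.
    by rewrite mem_filter => /andP [cS _]; rewrite in_S_lt // (in_SP rt).
  have [d [dS hd d_new]] : exists d, [/\ d \in S, adj (rho h) d &
      forall c, c \in S_row t h -> rho c != d].
    case: (S_row t h) hknown {known_S} => [_ | c cs' /andP [/allP same hv]].
      by have [d dS hd] := max_stable_nbr Smax hS; exists d; split.
    have [_ heavy] := rz_heavy rt hv.
    have [d [dS hd dc]] := heavy_nbr Smax (rho c) hS heavy; exists d; split=> //.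
    by move=> e; rewrite inE => /predU1P [-> | /same /eqP ->]; rewrite eq_sym.
  apply: some_realizable_cat.
  have [/hasP [c c_cs hc] | /hasPn no_old] :=
      boolP (has (fun c => adj (rho h) (rho c)) cs).
    left; apply: (some_realizable_map (x := c)) => //; exists rho.
    apply: realizes_add_edge => //.
    by move: c_cs; rewrite mem_filter mem_iota0 => /andP [].
  right; left; apply: (realizable_new_nbr rt _ h_lt dS hd).
    apply/allP=> _ /mapP [c c_cs ->] /=; rewrite h_lt no_old // andbT.
    by move: c_cs; rewrite mem_filter mem_iota0 => /andP [].
  move=> i i_lt; apply/eqP=> id; have hi : adj (rho h) (rho i) by rewrite id.
  have /no_old : i \in cs; last by rewrite hi.
  rewrite mem_filter mem_iota0 i_lt (rz_inS rt i_lt) id dS /= andbT.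
  rewrite (contraL (is_nonedgeP rt (v := i)) hi) andbT.
  by apply/negP=> /d_new; rewrite id eqxx.
- case: ifP => // /and4P [hs_uniq /allP hsH /allP hs_stable small] [<-].
  set known := flatten _ in small *; set ps := [seq (_, _) | _ <- _, _ <- _].
  have hs_lt h : h \in hs -> h < nverts t by case/hsH/andP.
  have [h [d [h_hs dS hd d_new]]] : exists h d, [/\ h \in hs, d \in S, adj (rho h) d &
      forall c, c \in known -> rho c != d].
    pose X := [set x in [seq rho h | h <- hs]].
    have cardX : #|X| = size hs.
      rewrite cardsE (card_uniqP _) ?size_map // map_inj_in_uniq // => a b.
      by move=> /hs_lt a_lt /hs_lt b_lt; apply: (rz_inj rt).
    have stX : stable X.
      apply/stableP=> _ _ /[!inE] /mapP [a a_hs ->] /mapP [b b_hs ->].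
      have /allP/(_ b b_hs)/orP [/eqP -> | /(is_nonedgeP rt) //] := hs_stable a a_hs.
      by rewrite adj_irrefl.
    have disX : [disjoint X & S].
      apply/pred0P=> z /=; apply/negP=> /andP [/[!inE] /mapP [a /hsH aH ->]].
      by apply/negP; apply: (in_HP rt).
    have /subsetPn [d] : ~~ (nbrs_in S X \subset [set x in [seq rho c | c <- undup known]]).
      apply: contraTN small => /subset_leq_card; rewrite -leqNgt => le_card.
      rewrite -cardX; apply: leq_trans (max_stable_hall Smax stX disX) _.
      by apply: leq_trans le_card _; rewrite cardsE (leq_trans (card_size _)) ?size_map.
    rewrite !inE => /andP [dS /existsP [z /andP [/[!inE] /mapP [h h_hs ->] hd]]] d_new.
    exists h, d; split=> // c c_known; apply: contraNneq d_new => <-.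
    by rewrite map_f // mem_undup.
  apply: some_realizable_cat.
  have ps_lt p : p \in ps -> p.1 < nverts t /\ p.2 < nverts t.
    case/allpairsPdep=> a [c [a_hs]]; rewrite mem_filter mem_iota0.
    by case/andP=> _ c_lt ->; rewrite hs_lt.
  have [/hasP [p p_ps pq] | /hasPn no_old] :=
      boolP (has (fun p => adj (rho p.1) (rho p.2)) ps).
    left; have [] := ps_lt p p_ps.
    by move=> *; apply: (some_realizable_map (x := p)) => //; exists rho; apply: realizes_add_edge.
  right; apply: (some_realizable_map (x := h)) => //.
  apply: (realizable_new_nbr rt _ (hs_lt h h_hs) dS hd).
    by apply/allP=> p p_ps; have [-> ->] := ps_lt p p_ps; apply: no_old.
  move=> i i_lt; apply/eqP=> id; have hi : adj (rho h) (rho i) by rewrite id.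
  have /no_old : (h, i) \in ps; last by rewrite hi.
  apply/allpairsPdep; exists h, i; split=> //.
  rewrite mem_filter mem_iota0 i_lt (rz_inS rt i_lt) id dS /= andbT.
  rewrite (contraL (is_nonedgeP rt (v := i)) hi) andbT.
  by apply/negP=> /d_new; rewrite id eqxx.
Qed.

(** Every rule keeps at least one branch realizable, and a closed branch has no
realization. *)
Lemma refutesP r t rho : refutes t r -> ~ realizes rho t.
Proof.
move: r t rho; fix IH 1; case=> [f | u v | f r | s rs] t rho /=.
- by case def_m: missing => [[|]|] // _ rt; have [_ []] := missingP rt def_m.
- case/andP=> uv + rt; have [_ _ adj_uv] := rz_edge rt uv.
  case/orP=> [/eqP e_uv | /(is_nonedgeP rt)]; last by rewrite adj_uv.
  by rewrite e_uv adj_irrefl in adj_uv.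
- case def_m: missing => [[|[b [u v]] [|]]|] //; last by case: b {def_m}.
    move=> ref rt; have [bnd [e]] := missingP rt def_m.
    rewrite inE => /eqP -> /=; have /= [u_lt v_lt] := bnd _ (mem_head _ _).
    case: b ref {def_m bnd} => ref uv; apply: (IH _ _ _ ref).
      by apply: (realizes_add_nonedge rt).
    by apply: (realizes_add_edge rt) => //; move: uv; case: adj.
- case def_ts: branches => [ts|] // ref rt; have := branchesP rt def_ts.
  elim: rs ts ref {def_ts} => [|r rs IHrs] [|t' ts] //= /andP [ref refs].
  by case=> [[rho' /(IH _ _ _ ref)] | /(IHrs _ refs)].
Qed.

End Soundness.

(** * Initial tableaux *)

Definition start (n : nat) (adjacent apart : rel nat) (ls hs : seq nat)
    (bar frc : seq (nat * nat)) : tableau :=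
  let rows (e : rel nat) := [seq [seq v <- iota 0 n | e u v] | u <- iota 0 n] in
  Tableau (nseq n false) (rows adjacent) (rows apart) ls hs bar frc.

Lemma mem_rows n (e : rel nat) u v :
  (v \in row [seq [seq v <- iota 0 n | e u v] | u <- iota 0 n] u) =
  [&& u < n, v < n & e u v].
Proof.
rewrite /row; case: (ltnP u n) => [u_lt | le_n]; last first.
  by rewrite nth_default // size_map size_iota.
by rewrite (nth_map 0) ?size_iota // nth_iota // mem_filter mem_iota0 andbC.
Qed.

Section Start.
Variables (G : sgraph) (S : {set G}) (rho : nat -> G) (n : nat).
Variables (adjacent apart : rel nat) (ls hs : seq nat) (bar frc : seq (nat * nat)).

Lemma realizes_start :
  (forall i j, i < n -> j < n -> rho i = rho j -> i = j) ->
  (forall i, i < n -> rho i \notin S) ->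
  (forall i j, i < n -> j < n -> adjacent i j -> adj (rho i) (rho j)) ->
  (forall i j, i < n -> j < n -> apart i j -> ~~ adj (rho i) (rho j)) ->
  (forall i, i \in ls -> i < n /\ light S (rho i)) ->
  (forall i, i \in hs -> i < n /\ ~~ light S (rho i)) ->
  (forall i j, (i, j) \in bar -> [/\ i < n, j < n &
     forall z, z \notin S -> adj z (rho i) -> ~~ adj z (rho j)]) ->
  (forall i j, (i, j) \in frc -> [/\ i < n, j < n &
     forall s, s \in S -> adj s (rho i) -> adj s (rho j)]) ->
  realizes S rho (start n adjacent apart ls hs bar frc).
Proof.
move=> rinj rS re rn rl rh rb rf.
have on : nverts (start n adjacent apart ls hs bar frc) = n by apply: size_nseq.
split; rewrite ?on //.
- by move=> i i_lt; rewrite /in_S nth_nseq i_lt (negPf (rS i i_lt)).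
- move=> u v; rewrite /is_edge mem_rows => /and3P [u_lt v_lt uv]; split=> //; exact: re.
- move=> u v; rewrite mem_rows => /and3P [u_lt v_lt uv]; split=> //; exact: rn.
Qed.
End Start.

Definition gap i j := (i - j) + (j - i).

Lemma gap_ind (P : nat -> nat -> Prop) :
  (forall a b, P a b -> P b a) -> (forall a k, P a (a + k)) -> forall a b, P a b.
Proof.
move=> symP ltP a b; case: (leqP a b) => [le_ab | /ltnW le_ba].
  by rewrite -(subnKC le_ab).
by apply: symP; rewrite -(subnKC le_ba).
Qed.

Lemma gapC a b : gap a b = gap b a. Proof. by rewrite /gap addnC. Qed.

(** Consecutive vertices of a shortest odd walk of length at least seven, labelled light
([Some true]), heavy ([Some false]) or not at all.  Vertices six steps apart are adjacent
when the length is seven.  By [chord_length] a vertex off [S] cannot be adjacent to two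
vertices whose distance is one, three or four. *)
Definition window_start (s : seq (option bool)) (frc : seq (nat * nat)) :=
  let n := size s in
  start n (fun i j => gap i j == 1) (fun i j => 1 < gap i j < 6)
    [seq i <- iota 0 n | nth None s i == Some true]
    [seq i <- iota 0 n | nth None s i == Some false]
    [seq (i, j) | i <- iota 0 n, j <- [seq j <- iota 0 n | gap i j \in [:: 1; 3; 4]]]
    frc.

(** A pentagon [0, ..., 4] off [S] and a further vertex [5] off [S] adjacent to [0], where
[0] is light or heavy according to [l]. *)
Definition pentagon_start (l : bool) :=
  start 6 (fun i j => ((gap i j == 1) || (gap i j == 4)) && (maxn i j < 5) ||
                      (gap i j == 5))
    (fun _ _ => false) (if l then [:: 0] else [::]) (if l then [::] else [:: 0]) [::] [::].

(** Five consecutive light vertices of a shortest odd walk of length at least seven, and a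
vertex [5] off [S] adjacent to the middle one. *)
Definition pendant_start :=
  start 6 (fun i j => (gap i j == 1) && (maxn i j < 5) || (minn i j == 2) && (maxn i j == 5))
    (fun i j => (1 < gap i j) && (maxn i j < 5)) (iota 0 5) [::]
    [seq (i, j) | i <- iota 0 5, j <- [seq j <- iota 0 5 | gap i j \in [:: 1; 3; 4]]]
    [::].

(** * Refutations *)

Section Refutations.

(** A refutation is a search tree whose meaning is fixed by [refutes].  New vertices get the
next free numbers in the order in which the queries introduce them. *)

Local Notation "f ;; r" := (Derive f r) (at level 60, right associativity).
Local Notation any := None (only parsing).
Local Notation L := (Some true) (only parsing).
Local Notation H := (Some false) (only parsing).

Definition HHLL_refutation :=
  Ask (OnNbr 4) [::
   Ask (OnHall [:: 1; 4]) [::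
    Ask (OnHall [:: 2; 4]) [::
     Ask (OnNbr 2) [::
      Ask (OnNbr 1) [::
       Ask (OnHall [:: 0; 2; 4]) [::
        [:: 2; 1; 9; 6; 4; 8; 10] ;; [:: 1; 0; 10; 2; 8; 7; 9] ;;
        [:: 1; 0; 10; 2; 6; 7; 9] ;; Fork [:: 0; 1; 7; 6; 4; 8; 10];
        Fork [:: 2; 1; 7; 6; 4; 8; 10]; Clash 4 10]];
      [:: 2; 1; 7; 3; 4; 8; 9] ;;
      Ask (OnNbr 1) [::
       [:: 1; 2; 9; 6; 4; 0; 7] ;; [:: 1; 2; 8; 6; 4; 0; 7] ;;
       Ask (OnUndominated 0 2) [::
        Fork [:: 1; 0; 10; 6; 4; 2; 7];
        Ask (OnHall [:: 1; 4; 10]) [::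
         Fork [:: 1; 0; 8; 6; 4; 7; 11]; Clash 4 11; [:: 2; 1; 11; 3; 4; 8; 9] ;;
         [:: 0; 1; 7; 10; 11; 8; 9] ;; [:: 0; 1; 6; 10; 11; 8; 9] ;;
         Fork [:: 10; 0; 8; 6; 4; 7; 11]]];
       Fork [:: 2; 1; 10; 3; 4; 8; 9]]];
     Clash 4 8];
    Clash 4 7]].

Lemma refutes_HHLL : refutes (window_start [:: any; H; H; L; L; any] [::]) HHLL_refutation.
Proof. by vm_compute. Qed.

Definition LHHH_refutation :=
  Ask (OnNbr 1) [::
   Ask (OnHall [:: 1; 3]) [::
    Clash 1 7;
    Ask (OnHall [:: 1; 4]) [::
     Clash 1 8;
     Ask (OnNbr 3) [::
      Ask (OnHall [:: 1; 3; 5]) [::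
       Clash 1 9; Fork [:: 3; 4; 8; 6; 1; 7; 9]; [:: 3; 4; 8; 6; 1; 7; 9] ;;
       Ask (OnNbr 4) [::
        [:: 4; 3; 7; 5; 9; 8; 10] ;; [:: 4; 3; 6; 5; 9; 8; 10] ;;
        Fork [:: 5; 4; 8; 6; 1; 7; 9]]];
      [:: 3; 2; 1; 4; 8; 7; 9] ;;
      Ask (OnNbr 2) [::
       Fork [:: 2; 1; 6; 3; 7; 8; 10]]]]]].

Lemma refutes_LHHH : refutes (window_start [:: any; L; H; H; H; any] [::]) LHHH_refutation.
Proof. by vm_compute. Qed.

Definition LHHLHHL_refutation :=
  Ask (OnNbr 3) [::
   Ask (OnNbr 0) [::
    Ask (OnHall [:: 0; 2]) [::
     Clash 0 9;
     Ask (OnHall [:: 1; 3]) [::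
      Ask (OnNbr 1) [::
       [:: 1; 0; 8; 2; 9; 7; 10] ;;
       Ask (OnPair 5 8) [::
        [:: 5; 4; 3; 10; 1; 6; 8] ;; [:: 2; 1; 10; 8; 5; 3; 9] ;;
        [:: 2; 1; 10; 3; 4; 8; 9] ;; Fork [:: 1; 2; 9; 10; 4; 0; 7];
        Ask (OnHall [:: 1; 3; 5]) [::
         [:: 5; 4; 3; 10; 1; 6; 9] ;; Fork [:: 2; 1; 10; 9; 5; 3; 8];
         Fork [:: 1; 0; 8; 7; 3; 10; 11]; Clash 3 11; [:: 2; 8; 0; 11; 5; 3; 9] ;;
         [:: 1; 0; 8; 7; 3; 10; 11] ;; [:: 5; 4; 3; 10; 1; 6; 11] ;;
         [:: 1; 2; 9; 7; 5; 0; 10] ;;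
         Ask (OnHall [:: 0; 2; 4]) [::
          [:: 4; 5; 11; 10; 1; 3; 9] ;; Fork [:: 1; 2; 9; 10; 4; 0; 7]; Clash 0 12;
          Fork [:: 2; 3; 7; 8; 0; 9; 12]; [:: 4; 5; 11; 8; 0; 3; 12] ;;
          [:: 4; 3; 7; 5; 11; 9; 12] ;; Fork [:: 2; 1; 10; 3; 4; 8; 9]]]];
       [:: 2; 1; 11; 3; 7; 8; 9] ;; Fork [:: 1; 0; 8; 2; 3; 10; 11]];
      Clash 3 10]]]].

Lemma refutes_LHHLHHL : refutes (window_start [:: L; H; H; L; H; H; L] [::]) LHHLHHL_refutation.
Proof. by vm_compute. Qed.

Definition monotone_refutation :=
  Ask (OnNbr 1) [::
   Ask (OnNbr 1) [::
    Ask (OnUndominated 7 8) [::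
     Ask (OnNbr 0) [::
      Ask (OnUndominated 8 7) [::
       Ask (OnNbr 0) [::
        Ask (OnPair 0 11) [::
         [:: 0; 9; 7; 11; 8; 10; 12] ;;
         Ask (OnPair 4 10) [::
          [:: 5; 4; 10; 8; 11; 7; 12] ;; [:: 3; 4; 10; 8; 11; 7; 12] ;;
          [:: 0; 1; 7; 10; 4; 11; 12] ;; [:: 0; 1; 7; 10; 4; 6; 11] ;;
          [:: 7; 1; 0; 5; 6; 3; 9] ;;
          Ask (OnPair 2 10) [::
           Ask (OnNbr 2) [::
            Ask (OnUndominated 0 2) [::
             Ask (OnHall [:: 1; 3; 5]) [::
              [:: 5; 4; 12; 8; 11; 7; 13] ;; [:: 13; 3; 2; 11; 0; 5; 9] ;;
              [:: 3; 2; 12; 7; 9; 8; 13] ;; [:: 3; 2; 10; 7; 9; 8; 13] ;;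
              [:: 12; 0; 11; 9; 7; 2; 4] ;; Fork [:: 5; 4; 10; 8; 11; 6; 7];
              [:: 5; 4; 12; 8; 11; 7; 13] ;; [:: 13; 3; 2; 11; 0; 5; 9] ;;
              [:: 3; 2; 12; 7; 9; 8; 13] ;; [:: 3; 2; 10; 7; 9; 8; 13] ;;
              [:: 12; 0; 11; 9; 7; 2; 4] ;; Fork [:: 5; 4; 10; 8; 11; 6; 7];
              [:: 5; 4; 12; 8; 11; 7; 13] ;; [:: 0; 1; 7; 11; 13; 10; 12] ;;
              [:: 13; 3; 2; 11; 0; 5; 9] ;; [:: 3; 2; 12; 7; 9; 8; 13] ;;
              [:: 3; 2; 10; 7; 9; 8; 13] ;; [:: 12; 0; 11; 9; 7; 2; 4] ;;
              Fork [:: 5; 4; 10; 8; 11; 6; 7]];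
             [:: 5; 4; 10; 8; 11; 6; 7] ;; [:: 1; 0; 13; 7; 9; 2; 8] ;;
             Fork [:: 0; 1; 7; 10; 6; 11; 13]; [:: 7; 3; 2; 13; 0; 5; 9] ;;
             Fork [:: 0; 1; 7; 10; 4; 11; 13]];
            [:: 3; 4; 12; 8; 11; 2; 7] ;; [:: 1; 0; 12; 7; 9; 2; 8] ;;
            Fork [:: 5; 4; 12; 8; 11; 6; 7]];
           [:: 3; 4; 10; 8; 11; 2; 7] ;; [:: 1; 0; 10; 7; 9; 2; 8] ;;
           Fork [:: 5; 4; 10; 8; 11; 6; 7]];
          [:: 0; 1; 7; 12; 4; 10; 11] ;;
          Ask (OnNbr 4) [::
           [:: 1; 0; 12; 13; 4; 7; 8] ;; [:: 0; 11; 8; 13; 4; 10; 12] ;;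
           [:: 7; 1; 0; 9; 13; 3; 5] ;; [:: 5; 4; 13; 10; 0; 7; 8] ;;
           [:: 3; 4; 13; 10; 0; 7; 8] ;; [:: 0; 1; 7; 11; 13; 10; 12] ;;
           Ask (OnPair 6 13) [::
            [:: 0; 6; 13; 11; 8; 10; 12] ;; [:: 7; 1; 0; 5; 6; 3; 9] ;;
            [:: 1; 2; 13; 7; 9; 0; 8] ;; [:: 3; 4; 13; 7; 9; 2; 8] ;;
            [:: 3; 2; 10; 4; 13; 7; 8] ;; [:: 4; 3; 2; 9; 10; 5; 13] ;;
            Fork [:: 1; 0; 10; 7; 9; 2; 8]; [:: 5; 4; 13; 8; 11; 6; 7] ;;
            [:: 5; 4; 13; 6; 12; 7; 8] ;; [:: 5; 4; 13; 6; 10; 7; 8] ;;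
            Fork [:: 0; 1; 7; 11; 6; 10; 12]]]];
         Ask (OnPair 6 11) [::
          Ask (OnLight 11) [::
           [:: 3; 8; 11; 12; 0; 2; 7] ;; [:: 3; 8; 11; 10; 0; 2; 7] ;;
           [:: 1; 0; 10; 8; 11; 2; 7] ;;
           Ask (OnHall [:: 1; 3; 11]) [::
            Fork [:: 1; 0; 10; 8; 11; 7; 13]; Fork [:: 3; 2; 10; 8; 11; 7; 13];
            Clash 11 13];
           Ask (OnPair 0 9) [::
            Ask (OnPair 4 10) [::
             [:: 0; 1; 8; 10; 4; 9; 12] ;; [:: 0; 1; 8; 10; 4; 6; 9] ;;
             Ask (OnPair 11 12) [::
              [:: 11; 9; 7; 12; 4; 6; 8] ;; [:: 5; 4; 12; 7; 9; 6; 8] ;;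
              Fork [:: 3; 7; 9; 8; 11; 2; 4]; [:: 1; 0; 12; 8; 11; 2; 7] ;;
              Ask (OnPair 10 11) [::
               [:: 11; 9; 7; 10; 4; 6; 8] ;; [:: 5; 4; 10; 7; 9; 6; 8] ;;
               Fork [:: 3; 7; 9; 8; 11; 2; 4]; [:: 1; 0; 10; 8; 11; 2; 7] ;;
               Ask (OnUndominated 0 2) [::
                Ask (OnNbr 11) [::
                 [:: 0; 1; 7; 13; 11; 10; 12] ;;
                 Ask (OnPair 9 13) [::
                  [:: 0; 1; 8; 9; 13; 10; 12] ;; Fork [:: 13; 3; 2; 9; 0; 5; 11];
                  [:: 5; 4; 12; 7; 9; 8; 13] ;; [:: 3; 4; 12; 7; 9; 8; 13] ;;
                  [:: 1; 2; 12; 7; 9; 8; 13] ;; Fork [:: 8; 1; 0; 11; 13; 3; 5]]];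
                [:: 5; 4; 10; 7; 9; 6; 8] ;; [:: 1; 0; 13; 8; 11; 2; 7] ;;
                Fork [:: 0; 1; 8; 10; 6; 9; 13]; [:: 8; 3; 2; 13; 0; 5; 11] ;;
                Fork [:: 0; 1; 8; 10; 4; 9; 13]]]];
             [:: 0; 1; 8; 12; 4; 9; 10] ;;
             Ask (OnNbr 4) [::
              [:: 1; 0; 12; 13; 4; 7; 8] ;; [:: 0; 9; 7; 13; 4; 10; 12] ;;
              [:: 8; 1; 0; 11; 13; 3; 5] ;; [:: 5; 4; 13; 10; 0; 7; 8] ;;
              [:: 3; 4; 13; 10; 0; 7; 8] ;; [:: 1; 2; 13; 8; 11; 0; 7] ;;
              [:: 3; 4; 13; 8; 11; 2; 7] ;; [:: 3; 2; 10; 4; 13; 7; 8] ;;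
              [:: 4; 3; 2; 11; 10; 5; 13] ;; Fork [:: 1; 0; 10; 8; 11; 2; 7]]];
            [:: 8; 1; 0; 11; 9; 3; 5] ;; [:: 1; 7; 9; 8; 11; 0; 2] ;;
            [:: 7; 1; 0; 5; 6; 3; 9] ;;
            Ask (OnNbr 6) [::
             [:: 0; 1; 8; 6; 13; 10; 12] ;; Clash 13 5]]];
          [:: 8; 1; 0; 5; 6; 3; 11] ;;
          Ask (OnNbr 6) [::
           [:: 0; 1; 8; 6; 13; 10; 12] ;; Clash 13 5]]]]]]]]].

(** The [S]-neighbourhoods of the vertices 1, 3, 5 increase. *)
Lemma refutes_mono :
  refutes (window_start [:: H; H; H; H; H; H; H] [:: (1, 3); (3, 5); (1, 5)]) monotone_refutation.
Proof. by vm_compute. Qed.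

Definition pendant_refutation :=
  Ask (OnNbr 1) [::
   Ask (OnNbr 3) [::
    Ask (OnNbr 2) [::
     Ask (OnHall [:: 1; 3; 5]) [::
      Clash 1 9; Clash 3 9; [:: 2; 3; 7; 5; 9; 1; 8] ;; [:: 2; 1; 6; 5; 9; 3; 8] ;;
      [:: 5; 2; 8; 9; 4; 6; 7] ;; [:: 5; 2; 8; 9; 0; 6; 7] ;;
      [:: 2; 3; 4; 5; 9; 1; 8] ;; Fork [:: 2; 1; 0; 5; 9; 3; 8]]]]].

Lemma refutes_pendant : refutes pendant_start pendant_refutation.
Proof. by vm_compute. Qed.

Definition heavy_pentagon_refutation :=
  Ask (OnNbr 0) [::
   Ask (OnNbr 4) [::
    Ask (OnNbr 0) [::
     Ask (OnNbr 1) [::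
      Ask (OnLight 4) [::
       Ask (OnNbr 5) [::
        Ask (OnLight 1) [::
         Clash 4 7;
         Ask (OnNbr 1) [::
          Ask (OnNbr 2) [::
           Ask (OnHall [:: 1; 4; 5]) [::
            Fork [:: 1; 2; 6; 7; 4; 9; 10]; Clash 4 10; [:: 1; 2; 6; 7; 4; 9; 10] ;;
            [:: 0; 1; 9; 5; 10; 6; 8] ;; [:: 5; 2; 6; 7; 4; 9; 10] ;;
            [:: 0; 5; 9; 6; 2; 4; 8] ;; [:: 2; 1; 9; 3; 4; 6; 8] ;;
            [:: 2; 1; 7; 3; 10; 6; 8] ;; Fork [:: 0; 4; 3; 5; 10; 1; 6]];
           Ask (OnHall [:: 1; 4; 5]) [::
            Fork [:: 1; 2; 8; 7; 4; 9; 10]; Clash 4 10; [:: 1; 2; 8; 7; 4; 9; 10] ;;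
            [:: 0; 1; 9; 5; 10; 6; 8] ;; [:: 5; 2; 8; 7; 4; 9; 10] ;;
            [:: 0; 5; 9; 8; 2; 4; 6] ;; [:: 2; 1; 9; 3; 4; 6; 8] ;;
            [:: 2; 1; 7; 3; 10; 6; 8] ;; Fork [:: 0; 4; 3; 5; 10; 1; 6]];
           [:: 1; 0; 8; 2; 10; 7; 9] ;; Fork [:: 0; 4; 7; 10; 2; 6; 8]]]];
        Fork [:: 0; 4; 7; 5; 9; 6; 8]];
       Ask (OnNbr 4) [::
        Ask (OnUndominated 7 0) [::
         Ask (OnLight 1) [::
          Ask (OnHall [:: 1; 5]) [::
           [:: 0; 1; 7; 5; 9; 6; 8] ;;
           Ask (OnHall [:: 1; 3]) [::
            Ask (OnHall [:: 1; 4; 5]) [::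
             Clash 1 11; Fork [:: 4; 3; 6; 7; 1; 9; 11]; [:: 5; 3; 6; 7; 1; 9; 11] ;;
             [:: 4; 3; 6; 7; 1; 9; 11] ;; [:: 0; 5; 9; 6; 3; 1; 8] ;;
             [:: 3; 2; 11; 4; 7; 6; 8] ;; [:: 3; 2; 1; 4; 9; 6; 8] ;;
             Fork [:: 0; 1; 2; 5; 11; 4; 6]];
            Ask (OnHall [:: 1; 4; 5]) [::
             Clash 1 11; Fork [:: 4; 3; 8; 7; 1; 9; 11]; [:: 5; 3; 8; 7; 1; 9; 11] ;;
             [:: 4; 3; 8; 7; 1; 9; 11] ;; [:: 0; 5; 9; 8; 3; 1; 6] ;;
             [:: 3; 2; 11; 4; 7; 6; 8] ;; [:: 3; 2; 1; 4; 9; 6; 8] ;;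
             Fork [:: 0; 1; 2; 5; 11; 4; 6]];
            Clash 1 11; [:: 4; 0; 8; 3; 11; 7; 9] ;; Fork [:: 0; 1; 7; 11; 3; 6; 8]];
           Clash 1 11; [:: 0; 4; 9; 5; 11; 6; 8] ;; [:: 4; 3; 8; 7; 1; 9; 11] ;;
           [:: 4; 3; 6; 7; 1; 9; 11] ;;
           Ask (OnHall [:: 1; 3]) [::
            Clash 1 12; Fork [:: 4; 3; 12; 7; 1; 9; 11]]];
          Ask (OnNbr 1) [::
           Ask (OnPair 2 6) [::
            Ask (OnNbr 3) [::
             Ask (OnPair 5 7) [::
              Ask (OnUndominated 9 7) [::
               Ask (OnPair 2 11) [::
                [:: 4; 0; 6; 9; 11; 3; 7] ;; Fork [:: 0; 1; 7; 8; 3; 6; 11];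
                [:: 0; 4; 7; 6; 2; 8; 11] ;; [:: 4; 3; 2; 9; 11; 0; 7] ;;
                Fork [:: 1; 0; 8; 9; 11; 2; 7]]];
              [:: 3; 2; 6; 4; 7; 5; 8] ;; Fork [:: 0; 1; 7; 8; 3; 5; 6]];
             [:: 4; 0; 8; 3; 11; 7; 9] ;; Fork [:: 0; 1; 7; 11; 3; 6; 8]];
            [:: 4; 0; 6; 3; 2; 7; 9] ;;
            Ask (OnNbr 2) [::
             Ask (OnPair 5 7) [::
              Ask (OnUndominated 9 7) [::
               Ask (OnPair 2 11) [::
                [:: 4; 0; 8; 9; 11; 3; 7] ;; Fork [:: 0; 1; 7; 6; 3; 8; 11];
                [:: 0; 4; 7; 8; 2; 6; 11] ;; [:: 4; 3; 2; 9; 11; 0; 7] ;;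
                Fork [:: 1; 0; 6; 9; 11; 2; 7]]];
              [:: 3; 2; 8; 4; 7; 5; 6] ;; Fork [:: 0; 1; 7; 6; 3; 5; 8]];
             [:: 1; 0; 8; 2; 11; 7; 9] ;; Fork [:: 0; 4; 7; 11; 2; 6; 8]]];
           [:: 0; 1; 11; 4; 9; 6; 8] ;;
           Ask (OnPair 2 6) [::
            Ask (OnNbr 3) [::
             [:: 4; 0; 8; 9; 2; 7; 11] ;;
             Ask (OnUndominated 9 7) [::
              Fork [:: 0; 1; 7; 5; 9; 6; 8]; [:: 2; 1; 7; 12; 9; 3; 6] ;;
              [:: 0; 1; 7; 12; 9; 6; 8] ;; [:: 4; 3; 2; 9; 12; 0; 7] ;;
              [:: 4; 0; 8; 9; 12; 7; 11] ;; Fork [:: 1; 0; 8; 11; 12; 2; 7]];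
             [:: 4; 0; 8; 3; 12; 9; 11] ;; Fork [:: 0; 1; 7; 12; 3; 6; 8]];
            [:: 4; 0; 6; 9; 2; 7; 11] ;; [:: 4; 0; 6; 3; 2; 7; 11] ;;
            [:: 0; 1; 2; 4; 9; 6; 8] ;;
            Ask (OnUndominated 9 7) [::
             Fork [:: 0; 1; 7; 5; 9; 6; 8]; [:: 2; 1; 7; 12; 9; 3; 8] ;;
             [:: 0; 1; 7; 12; 9; 6; 8] ;; [:: 4; 3; 2; 9; 12; 0; 7] ;;
             [:: 4; 0; 6; 9; 12; 7; 11] ;; Fork [:: 1; 0; 6; 11; 12; 2; 7]]]]]]]];
      [:: 0; 1; 9; 4; 7; 6; 8] ;;
      Ask (OnUndominated 9 0) [::
       Ask (OnLight 1) [::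
        Ask (OnNbr 3) [::
         Ask (OnHall [:: 1; 4; 5]) [::
          Clash 1 11; Fork [:: 4; 3; 6; 9; 1; 7; 11]; [:: 4; 3; 6; 9; 1; 7; 11] ;;
          [:: 0; 1; 9; 5; 11; 6; 8] ;; [:: 0; 4; 7; 5; 11; 6; 8] ;;
          [:: 5; 3; 6; 9; 1; 7; 11] ;; [:: 0; 5; 7; 6; 3; 1; 8] ;;
          [:: 3; 2; 11; 4; 9; 6; 8] ;; [:: 3; 2; 1; 4; 7; 6; 8] ;;
          Fork [:: 0; 1; 2; 5; 11; 4; 6]];
         Ask (OnHall [:: 1; 4; 5]) [::
          Clash 1 11; Fork [:: 4; 3; 8; 9; 1; 7; 11]; [:: 4; 3; 8; 9; 1; 7; 11] ;;
          [:: 0; 1; 9; 5; 11; 6; 8] ;; [:: 0; 4; 7; 5; 11; 6; 8] ;;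
          [:: 5; 3; 8; 9; 1; 7; 11] ;; [:: 0; 5; 7; 8; 3; 1; 6] ;;
          [:: 3; 2; 11; 4; 9; 6; 8] ;; [:: 3; 2; 1; 4; 7; 6; 8] ;;
          Fork [:: 0; 1; 2; 5; 11; 4; 6]];
         [:: 4; 0; 8; 3; 11; 7; 9] ;; Fork [:: 0; 1; 9; 11; 3; 6; 8]];
        Ask (OnNbr 1) [::
         [:: 0; 1; 11; 4; 7; 6; 8] ;;
         Ask (OnNbr 3) [::
          [:: 4; 0; 6; 7; 2; 9; 11] ;; [:: 0; 1; 2; 4; 7; 6; 8] ;;
          Ask (OnUndominated 7 9) [::
           Fork [:: 0; 1; 9; 5; 7; 6; 8]; [:: 2; 1; 9; 12; 7; 3; 8] ;;
           [:: 0; 1; 9; 12; 7; 6; 8] ;; [:: 4; 3; 2; 7; 12; 0; 9] ;;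
           [:: 4; 0; 6; 7; 12; 9; 11] ;; Fork [:: 1; 0; 6; 11; 12; 2; 9]];
          [:: 4; 0; 8; 7; 2; 9; 11] ;; [:: 0; 1; 2; 4; 7; 6; 8] ;;
          Ask (OnUndominated 7 9) [::
           Fork [:: 0; 1; 9; 5; 7; 6; 8]; [:: 2; 1; 9; 12; 7; 3; 6] ;;
           [:: 0; 1; 9; 12; 7; 6; 8] ;; [:: 4; 3; 2; 7; 12; 0; 9] ;;
           [:: 4; 0; 8; 7; 12; 9; 11] ;; Fork [:: 1; 0; 8; 11; 12; 2; 9]];
          [:: 4; 0; 8; 3; 12; 9; 11] ;; Fork [:: 0; 1; 9; 12; 3; 6; 8]]]]]]]]].

Definition light_pentagon_refutation :=
  Ask (OnNbr 0) [::
   Ask (OnHall [:: 0; 3]) [::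
    Clash 0 7;
    Ask (OnHall [:: 0; 2]) [::
     Clash 0 8;
     Ask (OnNbr 1) [::
      Ask (OnLight 1) [::
       Ask (OnLight 3) [::
        Clash 1 7;
        Ask (OnHall [:: 1; 5]) [::
         Ask (OnLight 2) [::
          Ask (OnHall [:: 2; 4]) [::
           Clash 2 9; [:: 0; 1; 2; 4; 9; 5; 6] ;; [:: 5; 0; 6; 8; 2; 7; 9] ;;
           [:: 0; 1; 7; 5; 8; 4; 6] ;;
           Ask (OnHall [:: 2; 4; 5]) [::
            Clash 2 10; Fork [:: 4; 0; 6; 8; 2; 9; 10];
            Fork [:: 5; 0; 6; 8; 2; 9; 10]]];
          Ask (OnHall [:: 1; 4]) [::
           Ask (OnHall [:: 1; 4; 5]) [::
            Clash 1 9; [:: 4; 0; 6; 3; 7; 8; 9] ;;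
            Ask (OnPair 5 9) [::
             Ask (OnUndominated 9 8) [::
              Ask (OnPair 6 10) [::
               [:: 4; 3; 7; 9; 10; 0; 8] ;; [:: 2; 1; 0; 10; 9; 3; 8] ;;
               Fork [:: 0; 1; 2; 6; 10; 4; 5]; [:: 1; 0; 6; 2; 8; 7; 10] ;;
               [:: 3; 4; 8; 7; 1; 6; 10] ;; [:: 4; 0; 1; 9; 10; 3; 8] ;;
               [:: 2; 3; 6; 9; 10; 1; 8] ;; [:: 0; 1; 7; 4; 8; 6; 10] ;;
               Ask (OnNbr 2) [::
                [:: 10; 0; 6; 11; 2; 7; 9] ;; [:: 3; 2; 11; 4; 9; 6; 7] ;;
                Fork [:: 4; 3; 6; 9; 10; 8; 11]]]];
             [:: 3; 4; 9; 7; 1; 5; 6] ;; [:: 0; 1; 2; 4; 9; 5; 6] ;;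
             Fork [:: 2; 3; 6; 8; 5; 1; 9]];
            Ask (OnUndominated 6 1) [::
             [:: 3; 4; 8; 7; 1; 6; 9] ;;
             Ask (OnUndominated 9 8) [::
              Ask (OnNbr 2) [::
               Ask (OnPair 0 10) [::
                [:: 3; 4; 8; 7; 1; 6; 10] ;; Fork [:: 2; 3; 6; 9; 10; 1; 8];
                [:: 3; 2; 8; 6; 0; 7; 10] ;; [:: 2; 1; 0; 9; 10; 3; 8] ;;
                [:: 5; 7; 3; 9; 10; 0; 8] ;; [:: 4; 3; 7; 9; 10; 0; 8] ;;
                Fork [:: 0; 1; 7; 5; 9; 4; 6]];
               [:: 3; 2; 8; 10; 9; 6; 7] ;; [:: 1; 2; 8; 10; 9; 0; 7] ;;
               [:: 0; 1; 2; 5; 9; 4; 6] ;; [:: 4; 0; 1; 9; 10; 3; 8] ;;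
               [:: 3; 2; 11; 4; 9; 6; 7] ;; [:: 4; 3; 6; 9; 10; 8; 11] ;;
               Fork [:: 2; 3; 6; 11; 10; 1; 8]]];
             [:: 5; 0; 6; 3; 7; 8; 9] ;; [:: 4; 0; 6; 3; 7; 8; 9] ;;
             [:: 0; 4; 3; 5; 9; 1; 6] ;; [:: 0; 1; 7; 5; 9; 4; 6] ;;
             [:: 5; 7; 1; 10; 6; 8; 9] ;; [:: 5; 0; 6; 8; 2; 7; 9] ;;
             [:: 3; 7; 1; 10; 6; 4; 9] ;; [:: 2; 6; 10; 8; 5; 1; 3] ;;
             Fork [:: 0; 4; 3; 6; 10; 1; 5]]];
           Clash 1 9; [:: 0; 4; 9; 5; 8; 1; 6] ;; [:: 0; 1; 7; 5; 8; 4; 6] ;;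
           [:: 5; 0; 6; 7; 3; 8; 9] ;; [:: 5; 0; 6; 8; 2; 7; 9] ;;
           Ask (OnUndominated 6 4) [::
            [:: 5; 9; 4; 10; 6; 7; 8] ;; [:: 2; 9; 4; 10; 6; 1; 8] ;;
            [:: 3; 6; 10; 7; 5; 2; 4] ;; Fork [:: 0; 1; 2; 6; 10; 4; 5]]]];
         Clash 1 9;
         Ask (OnPair 3 9) [::
          [:: 3; 2; 8; 4; 0; 7; 9] ;; Fork [:: 0; 4; 8; 5; 9; 1; 6];
          Ask (OnNbr 3) [::
           [:: 2; 3; 6; 5; 9; 1; 8] ;;
           Ask (OnPair 4 9) [::
            Ask (OnUndominated 6 4) [::
             Ask (OnPair 9 10) [::
              [:: 2; 1; 0; 10; 9; 3; 8] ;; [:: 0; 1; 2; 6; 10; 4; 5] ;;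
              [:: 3; 6; 10; 7; 5; 2; 4] ;; [:: 10; 1; 7; 9; 5; 6; 8] ;;
              [:: 0; 1; 7; 4; 8; 5; 6] ;; Fork [:: 1; 0; 4; 2; 8; 7; 10];
              Ask (OnPair 3 5) [::
               [:: 3; 4; 8; 7; 1; 5; 6] ;; [:: 3; 2; 8; 5; 9; 6; 7] ;;
               [:: 2; 9; 4; 10; 6; 1; 8] ;;
               Ask (OnHall [:: 0; 3; 10]) [::
                [:: 2; 1; 0; 8; 10; 3; 9] ;;
                Ask (OnHall [:: 4; 5]) [::
                 [:: 10; 1; 7; 11; 4; 6; 8] ;; [:: 3; 2; 8; 4; 11; 6; 7] ;;
                 Fork [:: 2; 3; 7; 8; 10; 9; 11]; [:: 10; 1; 7; 11; 5; 6; 8] ;;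
                 [:: 3; 2; 8; 5; 11; 6; 7] ;; Fork [:: 2; 3; 7; 8; 10; 9; 11]];
                Clash 0 11; Fork [:: 2; 1; 0; 3; 11; 8; 9]; [:: 3; 5; 9; 7; 1; 6; 11] ;;
                [:: 3; 2; 8; 6; 10; 4; 7] ;; [:: 3; 2; 8; 6; 10; 4; 5] ;;
                Fork [:: 5; 0; 1; 10; 11; 3; 9]];
               [:: 2; 3; 6; 9; 5; 1; 8] ;; [:: 3; 2; 8; 4; 9; 6; 7] ;;
               [:: 0; 1; 7; 4; 8; 5; 6] ;;
               Ask (OnHall [:: 0; 10]) [::
                [:: 7; 5; 9; 10; 8; 1; 3] ;; Fork [:: 0; 4; 8; 6; 10; 1; 5];
                [:: 7; 5; 9; 10; 8; 1; 3] ;; Fork [:: 3; 4; 9; 6; 10; 2; 7]; Clash 0 11;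
                [:: 4; 0; 1; 3; 11; 8; 9] ;; [:: 3; 4; 9; 6; 10; 2; 7] ;;
                Fork [:: 2; 1; 0; 10; 11; 3; 8]]]]];
            [:: 3; 5; 9; 7; 1; 4; 6] ;; [:: 0; 4; 8; 5; 9; 1; 6] ;;
            [:: 0; 1; 2; 5; 9; 4; 6] ;; Fork [:: 2; 3; 4; 9; 5; 1; 8]];
           [:: 3; 2; 8; 5; 0; 7; 10] ;; [:: 3; 2; 8; 4; 0; 7; 10] ;;
           [:: 4; 0; 6; 3; 10; 8; 9] ;; Fork [:: 0; 4; 3; 5; 9; 1; 6]]]]];
       Ask (OnNbr 1) [::
        [:: 1; 0; 6; 2; 8; 7; 9] ;;
        Ask (OnUndominated 6 1) [::
         Ask (OnPair 3 5) [::
          Ask (OnPair 5 9) [::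
           [:: 5; 0; 6; 3; 7; 8; 9] ;; [:: 3; 2; 6; 5; 9; 4; 7] ;;
           [:: 4; 0; 6; 3; 7; 8; 9] ;;
           Ask (OnHall [:: 4; 5]) [::
            Fork [:: 4; 0; 6; 3; 7; 9; 11]; Fork [:: 5; 0; 6; 3; 7; 9; 11]];
           [:: 3; 2; 6; 4; 9; 5; 7] ;; [:: 1; 0; 5; 2; 8; 7; 9] ;;
           [:: 1; 0; 4; 2; 8; 7; 9] ;;
           Ask (OnHall [:: 4; 5]) [::
            Fork [:: 4; 0; 6; 3; 7; 8; 11]; Fork [:: 5; 0; 6; 3; 7; 8; 11]]];
          Ask (OnHall [:: 1; 4; 5]) [::
           [:: 4; 0; 6; 3; 7; 8; 9] ;;
           Ask (OnPair 5 8) [::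
            Ask (OnLight 4) [::
             Ask (OnLight 3) [::
              [:: 2; 1; 9; 8; 5; 3; 6] ;; [:: 5; 0; 6; 7; 3; 8; 9] ;;
              Ask (OnHall [:: 0; 10]) [::
               [:: 5; 8; 2; 10; 7; 0; 9] ;; [:: 2; 6; 10; 8; 5; 1; 3] ;;
               Fork [:: 0; 4; 3; 6; 10; 1; 5]; [:: 0; 4; 3; 6; 10; 1; 5] ;;
               Fork [:: 0; 1; 7; 6; 10; 4; 5]; [:: 3; 4; 0; 10; 9; 2; 7] ;;
               [:: 2; 6; 10; 8; 5; 1; 3] ;; Fork [:: 0; 4; 3; 6; 10; 1; 5]; Clash 0 11;
               [:: 2; 3; 7; 6; 0; 8; 11] ;; [:: 2; 1; 9; 6; 10; 3; 8] ;;
               Fork [:: 3; 4; 0; 10; 11; 2; 7]];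
              Ask (OnNbr 3) [::
               Ask (OnUndominated 7 9) [::
                Fork [:: 3; 2; 6; 7; 5; 4; 9]; [:: 3; 4; 0; 7; 10; 2; 9] ;;
                Fork [:: 1; 2; 8; 7; 10; 0; 9];
                Ask (OnPair 0 11) [::
                 [:: 3; 2; 6; 7; 11; 4; 9] ;; Fork [:: 0; 1; 9; 4; 8; 6; 11];
                 [:: 2; 3; 9; 6; 0; 8; 11] ;; [:: 3; 4; 0; 7; 11; 2; 9] ;;
                 Fork [:: 1; 2; 8; 7; 11; 0; 9]]];
               [:: 2; 1; 9; 8; 5; 3; 6] ;; [:: 2; 1; 9; 3; 11; 6; 8] ;;
               [:: 5; 0; 6; 11; 3; 8; 9] ;; [:: 5; 0; 6; 7; 3; 8; 9] ;;
               Fork [:: 1; 2; 6; 9; 5; 7; 11]]];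
             Ask (OnNbr 4) [::
              Fork [:: 4; 0; 6; 3; 7; 8; 11]]];
            [:: 0; 1; 9; 4; 8; 5; 6] ;; [:: 0; 1; 7; 4; 8; 5; 6] ;;
            Ask (OnUndominated 9 7) [::
             [:: 3; 4; 0; 10; 9; 2; 7] ;; [:: 1; 2; 8; 9; 10; 0; 7] ;;
             Fork [:: 0; 4; 3; 6; 10; 1; 5];
             Ask (OnPair 6 11) [::
              [:: 3; 4; 0; 11; 9; 2; 7] ;; [:: 1; 2; 8; 9; 11; 0; 7] ;;
              Fork [:: 0; 4; 3; 6; 11; 1; 5]; [:: 4; 0; 6; 3; 7; 8; 11] ;;
              [:: 2; 1; 7; 8; 4; 6; 11] ;; [:: 3; 2; 6; 9; 11; 4; 7] ;;
              [:: 1; 0; 4; 9; 11; 2; 7] ;; [:: 0; 5; 7; 6; 2; 4; 11] ;;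
              [:: 0; 4; 8; 5; 7; 6; 11] ;;
              Ask (OnHall [:: 1; 3; 5]) [::
               [:: 1; 2; 6; 9; 11; 7; 12] ;; [:: 1; 0; 6; 7; 3; 9; 12] ;;
               Fork [:: 3; 2; 6; 12; 11; 4; 7]; [:: 11; 0; 6; 12; 3; 8; 9] ;;
               [:: 2; 1; 9; 3; 12; 6; 8] ;; Fork [:: 1; 2; 6; 9; 11; 7; 12];
               [:: 5; 2; 6; 9; 11; 7; 12] ;; [:: 5; 0; 6; 7; 3; 9; 12] ;;
               Fork [:: 3; 2; 6; 12; 11; 4; 7]]]]];
           [:: 2; 3; 4; 8; 5; 1; 6] ;; [:: 4; 0; 6; 3; 7; 8; 9] ;;
           Ask (OnPair 3 10) [::
            [:: 3; 4; 0; 10; 9; 2; 7] ;;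
            Ask (OnHall [:: 0; 2; 10]) [::
             Clash 0 11; Fork [:: 2; 3; 7; 6; 0; 8; 11]; [:: 4; 0; 6; 3; 7; 8; 11] ;;
             [:: 2; 3; 7; 6; 0; 8; 11] ;; Fork [:: 3; 4; 0; 10; 11; 2; 7]];
            Ask (OnPair 8 10) [::
             Fork [:: 0; 4; 3; 6; 10; 1; 5]; [:: 2; 6; 10; 8; 5; 1; 3] ;;
             Ask (OnPair 3 9) [::
              Ask (OnUndominated 7 9) [::
               Fork [:: 3; 2; 6; 7; 5; 4; 9]; Fork [:: 1; 2; 8; 7; 10; 0; 9];
               Ask (OnPair 4 11) [::
                [:: 4; 0; 6; 3; 9; 8; 11] ;; Fork [:: 1; 2; 8; 7; 11; 0; 9];
                [:: 2; 1; 9; 8; 4; 6; 11] ;; [:: 3; 4; 0; 7; 11; 2; 9] ;;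
                Fork [:: 3; 2; 6; 7; 11; 4; 9]]];
              [:: 2; 1; 9; 8; 5; 3; 6] ;; Fork [:: 2; 1; 9; 6; 10; 3; 8]]]];
           [:: 3; 2; 8; 4; 0; 7; 11] ;; [:: 3; 2; 8; 4; 0; 7; 9] ;;
           Fork [:: 1; 0; 6; 7; 3; 9; 11]; [:: 4; 0; 6; 3; 7; 9; 11] ;;
           Fork [:: 1; 0; 4; 2; 8; 7; 9]; [:: 3; 2; 8; 4; 0; 7; 11] ;;
           [:: 3; 2; 8; 4; 0; 7; 9] ;; [:: 1; 0; 4; 2; 8; 7; 9] ;;
           [:: 4; 0; 6; 3; 7; 9; 11] ;; [:: 1; 0; 6; 7; 3; 9; 11] ;;
           Fork [:: 0; 4; 3; 5; 11; 1; 6]]]]]];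
      Ask (OnHall [:: 1; 4]) [::
       Ask (OnHall [:: 2; 4]) [::
        [:: 4; 0; 6; 3; 7; 8; 9] ;; [:: 2; 1; 9; 3; 7; 6; 8] ;;
        Ask (OnUndominated 7 9) [::
         Fork [:: 0; 1; 9; 5; 7; 4; 6]; [:: 2; 1; 9; 10; 7; 6; 8] ;;
         [:: 0; 1; 9; 10; 7; 4; 6] ;; [:: 3; 4; 0; 7; 10; 2; 9] ;;
         [:: 4; 0; 6; 3; 9; 8; 10] ;; [:: 1; 2; 8; 10; 7; 0; 9] ;;
         Ask (OnHall [:: 1; 4; 5]) [::
          [:: 2; 6; 10; 8; 5; 1; 3] ;; Fork [:: 0; 4; 8; 5; 7; 1; 6];
          [:: 10; 4; 8; 11; 1; 6; 7] ;; [:: 2; 1; 11; 3; 7; 6; 8] ;;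
          Fork [:: 3; 2; 8; 7; 10; 9; 11]; Fork [:: 4; 0; 6; 3; 7; 8; 11];
          [:: 4; 3; 9; 10; 6; 8; 11] ;; [:: 2; 3; 9; 6; 0; 8; 11] ;;
          [:: 3; 2; 6; 5; 11; 7; 9] ;; [:: 2; 3; 7; 8; 5; 1; 6] ;;
          [:: 10; 4; 8; 11; 5; 6; 7] ;; [:: 0; 4; 8; 5; 11; 1; 6] ;;
          [:: 3; 2; 8; 7; 10; 9; 11] ;; Fork [:: 2; 1; 11; 3; 7; 6; 8]]];
        [:: 4; 0; 6; 3; 7; 8; 9] ;;
        Ask (OnHall [:: 1; 4; 5]) [::
         [:: 3; 2; 1; 7; 5; 4; 6] ;; Fork [:: 0; 4; 8; 5; 7; 1; 6];
         Fork [:: 1; 0; 6; 2; 8; 9; 10]; [:: 4; 3; 7; 9; 1; 8; 10] ;;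
         Fork [:: 1; 0; 6; 2; 8; 9; 10]; [:: 3; 2; 8; 6; 0; 7; 10] ;;
         [:: 2; 1; 9; 3; 7; 8; 10] ;; [:: 1; 0; 6; 2; 8; 9; 10] ;;
         [:: 4; 3; 7; 9; 1; 8; 10] ;; [:: 2; 3; 7; 5; 10; 1; 8] ;;
         Fork [:: 0; 1; 2; 5; 10; 4; 6]];
        Fork [:: 2; 1; 0; 3; 7; 8; 10]; [:: 4; 0; 1; 3; 7; 8; 10] ;;
        Fork [:: 1; 0; 6; 2; 8; 9; 10]];
       [:: 3; 2; 8; 4; 0; 7; 9] ;; [:: 1; 0; 6; 2; 8; 9; 10] ;;
       Fork [:: 2; 1; 9; 3; 7; 6; 8]; [:: 3; 2; 8; 4; 0; 7; 9] ;;
       [:: 2; 1; 0; 3; 7; 8; 10] ;; [:: 3; 2; 8; 4; 10; 6; 7] ;;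
       [:: 2; 1; 9; 3; 7; 6; 8] ;; [:: 4; 0; 6; 3; 7; 9; 10] ;;
       [:: 1; 0; 6; 2; 8; 9; 10] ;;
       Ask (OnPair 5 8) [::
        [:: 0; 4; 10; 5; 8; 1; 6] ;; [:: 0; 4; 3; 5; 8; 1; 6] ;;
        Fork [:: 5; 0; 1; 3; 7; 8; 10];
        Ask (OnPair 5 7) [::
         [:: 0; 1; 9; 5; 7; 4; 6] ;; [:: 0; 1; 2; 5; 7; 4; 6] ;;
         Fork [:: 5; 0; 4; 2; 8; 7; 9];
         Ask (OnHall [:: 1; 5]) [::
          [:: 2; 3; 7; 5; 10; 1; 8] ;;
          Ask (OnHall [:: 1; 4; 5]) [::
           Fork [:: 1; 0; 6; 2; 8; 9; 11]; Fork [:: 4; 0; 6; 3; 7; 10; 11];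
           [:: 4; 0; 6; 3; 7; 10; 11] ;; [:: 2; 1; 9; 3; 7; 8; 11] ;;
           [:: 1; 0; 6; 2; 8; 9; 11] ;; Fork [:: 0; 1; 2; 5; 11; 4; 6]];
          Fork [:: 1; 0; 6; 2; 8; 9; 11]; [:: 4; 0; 6; 3; 7; 10; 11] ;;
          [:: 3; 2; 8; 4; 10; 7; 11] ;; [:: 3; 2; 8; 4; 10; 5; 7] ;;
          [:: 1; 0; 6; 2; 8; 9; 11] ;; Fork [:: 0; 4; 3; 5; 11; 1; 6]]]]]]]]].

Lemma refutes_pentagon b :
  refutes (pentagon_start b) (if b then light_pentagon_refutation else heavy_pentagon_refutation).
Proof. by case: b; vm_compute. Qed.

End Refutations.

(** * Windows and chains *)

Section Local.
Variables (G : sgraph) (S : {set G}).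
Hypothesis tf : triangle_free G.
Hypothesis ff : fork_free G.
Hypothesis und : undominated G.
Hypothesis Smax : max_stable S.

(** Stated for an arbitrary sequence [d] so that a window can also be read backwards. *)
Record window (d : nat -> G) : Prop := Window {
  window_inj : forall a b, a < 7 -> b < 7 -> d a = d b -> a = b;
  window_off : forall a, a < 7 -> d a \notin S;
  window_adj : forall a b, a < 7 -> b < 7 -> gap a b = 1 -> adj (d a) (d b);
  window_apart : forall a b, a < 7 -> b < 7 -> 1 < gap a b < 6 -> ~~ adj (d a) (d b);
  window_bar : forall a b, a < 7 -> b < 7 -> gap a b \in [:: 1; 3; 4] ->
    forall z, z \notin S -> adj z (d a) -> ~~ adj z (d b)
}.

Lemma window_rev d : window d -> window (fun j => d (6 - j)).
Proof.
have lt7 a : 6 - a < 7 by lia.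
have rev_gap a b : a < 7 -> b < 7 -> gap (6 - a) (6 - b) = gap a b.
  by rewrite /gap; lia.
case=> dinj doff dadj dap dbar; split.
- by move=> a b a7 b7 dab; have := dinj _ _ (lt7 a) (lt7 b) dab; lia.
- by move=> a _; apply: doff.
- by move=> a b a7 b7; rewrite -rev_gap //; apply: dadj.
- by move=> a b a7 b7; rewrite -rev_gap //; apply: dap.
- by move=> a b a7 b7; rewrite -rev_gap //; apply: dbar.
Qed.

Lemma window_refuted s frc r d : refutes (window_start s frc) r -> size s <= 7 ->
  window d ->
  (forall i j, (i, j) \in frc -> [/\ i < size s, j < size s &
     forall s, s \in S -> adj s (d i) -> adj s (d j)]) ->
  ~ (forall j b, nth None s j = Some b -> light S (d j) = b).
Proof.
move=> ref sz [dinj doff dadj dap dbar] frcP lab; have lt7 j : j < size s -> j < 7 by lia.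
apply: (refutesP tf ff und Smax ref (rho := d)); apply: realizes_start => //.
- by move=> i j /lt7 i7 /lt7; apply: dinj.
- by move=> i /lt7; apply: doff.
- by move=> i j /lt7 i7 /lt7 j7 /eqP; apply: dadj.
- by move=> i j /lt7 i7 /lt7; apply: dap.
- by move=> i; rewrite mem_filter mem_iota0 => /andP [/eqP /lab].
- by move=> i; rewrite mem_filter mem_iota0 => /andP [/eqP /lab ->].
- move=> i j /allpairsPdep [i' [j' [+ + [-> ->]]]].
  rewrite mem_filter !mem_iota0 => i_lt /andP [gij j_lt]; split=> //.
  by apply: dbar; rewrite ?lt7.
Qed.

(** Two neighbours of [x] in [S], a vertex of [S] adjacent to [a] but not to [b] and one
adjacent to [b] but not to [a] would form a fork with centre [x]. *)
Lemma heavy_chain x a b : x \notin S -> ~~ light S x -> a \notin S -> b \notin S ->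
  adj x a -> adj x b ->
  (forall s, s \in S -> adj s a -> adj s b) \/ (forall s, s \in S -> adj s b -> adj s a).
Proof.
move=> xS heavy aS bS xa xb; have [g gS xg] := max_stable_nbr Smax xS.
have [h [hS xh hg]] := heavy_nbr Smax g xS heavy.
case: (boolP [forall s in S, adj s a ==> adj s b]) => [/forall_inP sub | ].
  by left=> s /sub /implyP.
rewrite negb_forall_in => /exists_inP [s sS]; rewrite negb_imply => /andP [sa sb].
right=> t tS tb; apply: contraT => ta.
(* The vertices [s] and [t] are not adjacent to [g] or [h] since all four lie in [S]. *)
have := @ff x a s b t g h; rewrite eq_sym hg /= xa xb xg xh.
rewrite ![adj a s]adj_sym ![adj b t]adj_sym sa tb => /(_ isT isT).
by rewrite sb ta !(max_stable_adj Smax).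
Qed.

End Local.

(** * Odd components are odd cycles *)

Section OddComponent.
Variables (G : sgraph) (S : {set G}).
Hypothesis tf : triangle_free G.
Hypothesis ff : fork_free G.
Hypothesis und : undominated G.
Hypothesis Smax : max_stable S.
Variables (K : {set G}) (n : nat) (c : nat -> G).
Hypothesis K_off : forall x, x \in K -> x \notin S.
Hypothesis K_closed : forall x y, x \in K -> y \notin S -> adj x y -> y \in K.
Hypothesis cP : shortest_odd_walk K n c.

Let n_gt4 : 4 < n := walk_length cP tf.

Lemma c_off i : c i \notin S. Proof. exact/K_off/(sow_in cP). Qed.

Lemma c_in z i : z \notin S -> adj z (c i) -> z \in K.
Proof. by move=> zS zi; apply: K_closed (sow_in cP i) zS _; rewrite adj_sym. Qed.

Lemma walk_window i : 6 < n -> window S (fun j => c (i + j)).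
Proof.
move=> n_gt6; have gapk a k : gap a (a + k) = k by rewrite /gap; lia.
split.
- apply: gap_ind => [a b H b7 a7 /esym /H -> // | a k a7 k7].
  rewrite addnA => /eqP; apply: contraTeq => ak.
  by apply: (walk_inj cP); lia.
- by move=> a _; apply: c_off.
- apply: gap_ind => [a b H b7 a7 | a k a7 k7]; first by rewrite gapC adj_sym; apply: H.
  by rewrite gapk => ->; rewrite addn1 addnS; apply: (sow_adj cP).
- apply: gap_ind => [a b H b7 a7 | a k a7 k7]; first by rewrite gapC adj_sym; apply: H.
  rewrite gapk addnA => k_bnd; apply/negP => /(walk_chordless cP tf).
  by lia.
- apply: gap_ind => [a b H b7 a7 | a k a7 k7].
    rewrite gapC => gab z zS zb; apply: contraTN zb; exact: H.
  rewrite gapk addnA !inE => k_bnd z zS za; apply/negP => zb.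
  by have := chord_length cP (c_in zS za) _ za zb; lia.
Qed.

Let heavy i := ~~ light S (c i).

Lemma no_window i s r : 6 < n -> refutes (window_start s [::]) r -> size s <= 7 ->
  ~ (forall j b, nth None s j = Some b -> light S (c (i + j)) = b).
Proof.
move=> n_gt6 ref sz; exact: (window_refuted tf ff und Smax ref sz (walk_window i n_gt6)).
Qed.

Lemma no_HHLL i : 6 < n ->
  ~ [/\ heavy i.+1, heavy i.+2, ~~ heavy i.+3 & ~~ heavy i.+4].
Proof.
move=> n_gt6 [/negbTE h1 /negbTE h2 /negbNE h3 /negbNE h4].
apply: (no_window n_gt6 refutes_HHLL isT (i := i)).
by case=> [|[|[|[|[|[|[|j]]]]]]] b //= [<-]; rewrite addnC.
Qed.

Lemma no_LHHH i : 6 < n ->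
  ~ [/\ ~~ heavy i.+1, heavy i.+2, heavy i.+3 & heavy i.+4].
Proof.
move=> n_gt6 [/negbNE h1 /negbTE h2 /negbTE h3 /negbTE h4].
apply: (no_window n_gt6 refutes_LHHH isT (i := i)).
by case=> [|[|[|[|[|[|[|j]]]]]]] b //= [<-]; rewrite addnC.
Qed.

Lemma no_LHHLHHL i : 6 < n ->
  ~ [/\ ~~ heavy i, heavy i.+1 && heavy i.+2, ~~ heavy i.+3, heavy i.+4 && heavy i.+1.+4
      & ~~ heavy i.+2.+4].
Proof.
move=> n_gt6 [/negbNE h0 /andP [/negbTE h1 /negbTE h2] /negbNE h3
  /andP [/negbTE h4 /negbTE h5] /negbNE h6].
apply: (no_window n_gt6 refutes_LHHLHHL isT (i := i)).
by case=> [|[|[|[|[|[|[|[|j]]]]]]]] b //= [<-]; rewrite addnC.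
Qed.

(** By [heavy_chain] the two light vertices would have the same neighbour in [S]. *)
Lemma no_LHL i : ~ [/\ ~~ heavy i, heavy i.+1 & ~~ heavy i.+2].
Proof.
case=> /negbNE l0 h1 /negbNE l2.
have apart : c i != c i.+2 by rewrite -addn2; apply: (walk_inj cP); lia.
have back : adj (c i.+1) (c i) by rewrite adj_sym; apply: (sow_adj cP).
have [s0 s0S s0i] := max_stable_nbr Smax (c_off i).
have [s2 s2S s2i] := max_stable_nbr Smax (c_off i.+2).
case: (heavy_chain ff Smax (c_off _) h1 (c_off _) (c_off _) back (sow_adj cP _)) => sub.
  have := light_inj Smax tf l0 l2 s0S s0i; rewrite adj_sym sub // 1?adj_sym // => /(_ isT).
  by move/eqP; rewrite (negPf apart).
have := light_inj Smax tf l2 l0 s2S s2i; rewrite adj_sym sub // 1?adj_sym // => /(_ isT).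
by move/esym/eqP; rewrite (negPf apart).
Qed.

Lemma heavy_period i m : heavy (i + m * n) = heavy i.
Proof. by rewrite /heavy (walk_wrap cP). Qed.

Let le i := [forall s in S, adj s (c i) ==> adj s (c i.+2)].
Let ge i := [forall s in S, adj s (c i.+2) ==> adj s (c i)].

(** By [heavy_chain] at [c i.+1] the [S]-neighbourhoods of [c i] and [c i.+2] are comparable
for every [i].  Steps by two run through the whole walk in one cycle of odd length, so
the directions of these inclusions cannot alternate: two consecutive ones agree, which
is the refuted window, read forwards or backwards. *)
Lemma no_all_heavy : 6 < n -> ~ (forall i, heavy i).
Proof.
move=> n_gt6 allH.
have labels (s := nseq 7 (Some false)) d : (forall j, exists k, d j = c k) ->
    forall j b, nth None s j = Some b -> light S (d j) = b.
  move=> dP j b /= nth_j; have <- : false = b.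
    by case: j nth_j => [|[|[|[|[|[|[|[|j]]]]]]]] //= [].
  by have [k ->] := dP j; apply/negbTE/allH.
have comparable i : le i || ge i.
  have back : adj (c i.+1) (c i) by rewrite adj_sym; apply: (sow_adj cP).
  case: (heavy_chain ff Smax (c_off _) (allH i.+1) (c_off _) (c_off _) back (sow_adj cP _)) => sub.
    by apply/orP; left; apply/forall_inP=> s sS; apply/implyP; apply: sub.
  by apply/orP; right; apply/forall_inP=> s sS; apply/implyP; apply: sub.
have no_le i : le i.+1 -> ~~ le i.+3.
  move=> /forall_inP le1; apply/negP=> /forall_inP le3.
  apply: (window_refuted tf ff und Smax refutes_mono isT (walk_window i n_gt6) _ (labels _ _))
    => [|j]; last by eexists.
  have le13 s : s \in S -> adj s (c (i + 1)) -> adj s (c (i + 3)).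
    by rewrite !addnS addn0 => sS; apply/implyP/le1.
  have le35 s : s \in S -> adj s (c (i + 3)) -> adj s (c (i + 5)).
    by rewrite !addnS addn0 => sS; apply/implyP/le3.
  move=> a b; rewrite !inE => /or3P [] /eqP [-> ->]; split=> // s sS sa.
  by apply/le35/le13.
have no_ge i : ge i.+1 -> ~~ ge i.+3.
  move=> /forall_inP ge1; apply/negP=> /forall_inP ge3.
  apply: (window_refuted tf ff und Smax refutes_mono isT (window_rev (walk_window i n_gt6)) _
    (labels _ _)) => [|j]; last by eexists.
  have ge31 s : s \in S -> adj s (c (i + 3)) -> adj s (c (i + 1)).
    by rewrite !addnS addn0 => sS; apply/implyP/ge1.
  have ge53 s : s \in S -> adj s (c (i + 5)) -> adj s (c (i + 3)).
    by rewrite !addnS addn0 => sS; apply/implyP/ge3.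
  move=> a b; rewrite !inE => /or3P [] /eqP [-> ->]; split=> // s sS sa.
  by apply/ge31/ge53.
(* If no two consecutive inclusions agree, they alternate, which is absurd after [n] steps
   by two. *)
have alternate i : le i.+3 = ~~ le i.+1.
  case: (boolP (le i.+1)) => [/no_le/negbTE // | not_le] /=.
  have /no_ge not_ge : ge i.+1 by have := comparable i.+1; rewrite (negPf not_le).
  by have := comparable i.+3; rewrite (negPf not_ge) orbF.
have shift k : le (k * 2).+1 = odd k (+) le 1.
  elim: k => // k IHk; rewrite mulSn !addSn add0n alternate IHk.
  by rewrite /= -addNb.
have period k : le (k + n) = le k by rewrite /le -!addSn !(sow_period cP).
have := shift n; rewrite (sow_odd cP) muln2 -addnn -[_.+1]/(1 + (n + n)) addnA !period.
by case: le.
Qed.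

(** A light vertex followed by a heavy one starts the pattern LHHLHHL: each further letter
is forced by one of the excluded patterns. *)
Lemma all_light : 6 < n -> forall i, light S (c i).
Proof.
move=> n_gt6 i0; apply/negbNE; apply/negP=> heavy0.
have [j0 light0] : exists j, ~~ heavy j.
  have [/existsP [j lj] | none] := boolP [exists j : 'I_n, ~~ heavy j]; first by exists j.
  case: (no_all_heavy n_gt6) => i; apply: contraR none => li; apply/existsP.
  have i_lt : i %% n < n by rewrite ltn_pmod; lia.
  by exists (Ordinal i_lt); rewrite -(heavy_period _ (i %/ n)) /= addnC -divn_eq.
(* The offset [n] ensures that there is a vertex before the first letter of the pattern. *)
have [m lm hm] : exists2 m, ~~ heavy m.+1 & heavy m.+2.
  have [|k hk min_k] := @ex_minnP (fun k => heavy (j0 + n + k)).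
    exists (i0 + j0 * (n - 1)); have -> : j0 + n + (i0 + j0 * (n - 1)) = i0 + j0.+1 * n.
      by case: n n_gt6 => // n' _; rewrite subn1 /=; lia.
    by rewrite heavy_period.
  case: k => [|k] in hk min_k.
    by move: hk; rewrite addn0 -[n in j0 + n]mul1n heavy_period (negPf light0).
  have pred_k : (j0 + n + k).-1.+1 = j0 + n + k by lia.
  exists (j0 + n + k).-1; rewrite pred_k; last by rewrite -addnS.
  by apply/negP=> /min_k; rewrite ltnn.
have HH k : ~~ heavy k.+1 -> heavy k.+2 -> heavy k.+3 && ~~ heavy k.+4.
  move=> lk hk; have -> : heavy k.+3 by apply: contraT => l3; case: (@no_LHL k.+1).
  by apply/negP => h4; case: (no_LHHH n_gt6 (i := k)); split=> //;
     apply: contraT => l3; case: (@no_LHL k.+1).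
have /andP [h3 l4] := HH m lm hm.
have h5 : heavy m.+1.+4.
  by apply: contraT => l5; case: (no_HHLL n_gt6 (i := m.+1)).
have /andP [h6 l7] := HH m.+3 l4 h5.
by case: (no_LHHLHHL n_gt6 (i := m.+1)); split=> //; apply/andP.
Qed.

(** The vertex [z] and the five vertices of the walk around [c i] realize [pendant_start]. *)
Lemma no_pendant i z : 6 < n -> z \notin S -> adj z (c i) -> exists j, z = c j.
Proof.
move=> n_gt6 zS zi; case: (on_walkP cP z) => // zc.
(* The window starts two steps before [c i]. *)
have [dinj doff dadj dap dbar] := walk_window (i + n - 2) n_gt6.
have z2 : adj z (c (i + n - 2 + 2)) by rewrite subnK ?(sow_period cP) //; lia.
exfalso; pose rho j := if j == 5 then z else c (i + n - 2 + j).
have old j : j < 5 -> rho j = c (i + n - 2 + j) by case: j => [|[|[|[|[|j]]]]].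
apply: (refutesP tf ff und Smax refutes_pendant (rho := rho)).
apply: realizes_start => //.
- move=> a b a6 b6; rewrite /rho; case: eqP => [-> | a5]; case: eqP => [-> | b5] //.
  + by move/eqP; rewrite (negPf (zc _)).
  + by move/esym/eqP; rewrite (negPf (zc _)).
  + by apply: dinj; lia.
- by move=> a a6; rewrite /rho; case: eqP => // _; apply: c_off.
- move=> a b a6 b6; case/orP=> /andP [] => [/eqP gab mab | mab Mab].
    by rewrite !old; [apply: dadj; lia | lia | lia].
  have [[-> ->] | [-> ->]] : (a = 2 /\ b = 5) \/ (a = 5 /\ b = 2) by lia.
    by rewrite adj_sym.
  by [].
- move=> a b a6 b6 /andP [gab mab]; rewrite !old; [ | lia | lia].
  by apply: dap; rewrite /gap in gab *; lia.
- move=> a; rewrite mem_iota0 => a5; split; first by lia.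
  by rewrite old //; apply: (all_light n_gt6).
- move=> a b /allpairsPdep [a' [b' [+ + [-> ->]]]].
  rewrite mem_filter !mem_iota0 => a5 /andP [gab b5]; rewrite !old //.
  by split; [lia | lia | apply: dbar => //; lia].
Qed.

Lemma no_pentagon_pendant i z : n = 5 -> z \notin S -> adj z (c i) -> exists j, z = c j.
Proof.
move=> n5 zS zi; case: (on_walkP cP z) => // zc.
exfalso; pose rho j := if j == 5 then z else c (i + j).
have old j : j < 5 -> rho j = c (i + j) by case: j => [|[|[|[|[|j]]]]].
have dinj : forall a b, a < 5 -> b < 5 -> c (i + a) = c (i + b) -> a = b.
  apply: gap_ind => [a b dab b5 a5 /esym /dab -> // | a k a5 k5].
  rewrite addnA => /eqP; apply: contraTeq => ak.
  by apply: (walk_inj cP); lia.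
have dadj : forall a b, a < 5 -> b < 5 -> (gap a b == 1) || (gap a b == 4) ->
    adj (c (i + a)) (c (i + b)).
  apply: gap_ind => [a b H b5 a5 | a k a5 k5]; first by rewrite gapC adj_sym; apply: H.
  have -> : gap a (a + k) = k by rewrite /gap; lia.
  case/orP=> /eqP def_k; first by rewrite def_k addn1 addnS; apply: (sow_adj cP).
  have -> : a = 0 by lia.
  have := sow_adj cP (i + 4); rewrite (_ : (i + 4).+1 = i + n) ?(sow_period cP); last by lia.
  by rewrite addn0 def_k adj_sym.
apply: (refutesP tf ff und Smax (refutes_pentagon (light S (c i))) (rho := rho)).
apply: realizes_start => //.
- move=> a b a6 b6; rewrite /rho; case: eqP => [-> | a5]; case: eqP => [-> | b5] //.
  + by move/eqP; rewrite (negPf (zc _)).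
  + by move/esym/eqP; rewrite (negPf (zc _)).
  + by apply: dinj; lia.
- by move=> a a6; rewrite /rho; case: eqP => // _; apply: c_off.
- move=> a b a6 b6; case/orP=> [/andP [gab mab] | /eqP gab].
    by rewrite !old; [apply: dadj; lia | lia | lia].
  have [[-> ->] | [-> ->]] : (a = 0 /\ b = 5) \/ (a = 5 /\ b = 0) by rewrite /gap in gab; lia.
    by rewrite adj_sym /rho addn0.
  by rewrite /rho addn0.
- by move=> a; case: ifP => // lc; rewrite inE => /eqP ->; rewrite /rho addn0.
- by move=> a; case: ifP => // lc; rewrite inE => /eqP ->; rewrite /rho addn0 lc.
Qed.

Lemma no_off_cycle i z : z \notin S -> adj z (c i) -> exists j, z = c j.
Proof.
have [n_gt6 | n_le6] := ltnP 6 n; first exact: no_pendant.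
apply: no_pentagon_pendant; have := sow_odd cP.
by case: n n_gt4 n_le6 => [|[|[|[|[|[|[|m]]]]]]].
Qed.

(** The vertex [y] is light: otherwise, by [heavy_chain] at [y], the [S]-neighbourhoods of
[w] and [x] are comparable, and a common neighbour of them is adjacent to [u] and [x].
If [w] is light, its neighbour in [S] is adjacent to [u] too; if it is heavy, then
[heavy_chain] at [w] gives a common neighbour of [y] and [h] in [S]. *)
Lemma heavy_pentagon_nbrs (h u x y w : G) :
  [&& h \notin S, u \notin S, x \notin S, y \notin S & w \notin S] ->
  adj h u -> adj u x -> adj x y -> adj y w -> adj w h -> u != w -> y != h ->
  ~~ light S h -> (forall s, s \in S -> adj s w -> adj s u) ->
  exists v k s, [/\ light S v, v \in [:: y; w], k \in [:: h; u; w], s \in S &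
    [/\ adj s v, adj s k & k != v]].
Proof.
case/and5P=> hS uS xS yS wS hu ux xy yw wh uw yh hH sub_wu.
have triangle (a b d : G) : adj a b -> adj a d -> adj b d -> False.
  by move=> ab ad bd; have := tf ab bd; rewrite ad.
have ly : light S y.
  apply: contraT => hy; have yx : adj y x by rewrite adj_sym.
  case: (heavy_chain ff Smax yS hy xS wS yx yw) => sub.
    have [s sS xs] := max_stable_nbr Smax xS; rewrite adj_sym in xs.
    by case: (triangle s u x) => //; apply/sub_wu/sub.
  have [s sS ws] := max_stable_nbr Smax wS; rewrite adj_sym in ws.
  by case: (triangle s u x) => //; [apply: sub_wu | apply: sub].
case: (boolP (light S w)) => [lw | hw].
  have [s sS ws] := max_stable_nbr Smax wS; rewrite adj_sym in ws.
  by exists w, u, s; rewrite !inE !eqxx ?orbT; split=> //; split=> //; apply: sub_wu.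
have wy : adj w y by rewrite adj_sym.
case: (heavy_chain ff Smax wS hw hS yS wh wy) => sub.
  have [s sS hs] := max_stable_nbr Smax hS; rewrite adj_sym in hs.
  by exists y, h, s; rewrite !inE !eqxx ?orbT; split=> //; split=> //;
    [apply: sub | rewrite eq_sym].
have [s sS ys] := max_stable_nbr Smax yS; rewrite adj_sym in ys.
by exists y, h, s; rewrite !inE !eqxx ?orbT; split=> //; split=> //;
    [apply: sub | rewrite eq_sym].
Qed.

(** By [heavy_chain] the [S]-neighbourhoods of the two neighbours of a heavy vertex on the
pentagon are comparable, so that [heavy_pentagon_nbrs] applies in one of the two
directions. *)
Lemma light_or_shared i : light S (c i) \/
  n = 5 /\ exists j k s, [/\ light S (c j), s \in S, adj s (c j), adj s (c k) & c k != c j].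
Proof.
have [n_gt6 | n_le6] := ltnP 6 n.
  by left; exact: (all_light n_gt6).
have n5 : n = 5.
  by have := sow_odd cP; case: n n_gt4 n_le6 => [|[|[|[|[|[|[|m]]]]]]].
case: (boolP (light S (c i))) => [li | hi]; first by left.
right; split=> //.
have next k : adj (c (i + k)) (c (i + k.+1)) by rewrite addnS; apply: (sow_adj cP).
have e01 : adj (c i) (c (i + 1)) by have := next 0; rewrite addn0.
have e40 : adj (c (i + 4)) (c i) by have := next 4; rewrite -[4.+1]n5 (sow_period cP).
have d14 : c (i + 1) != c (i + 4).
  by have := @walk_inj _ _ _ _ cP (i + 1) 3; rewrite -addnA; apply; lia.
have d03 : c i != c (i + 3) by apply: (walk_inj cP); lia.
have d02 : c i != c (i + 2) by apply: (walk_inj cP); lia.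
have back k : adj (c (i + k.+1)) (c (i + k)) by rewrite adj_sym.
have e10 : adj (c (i + 1)) (c i) by rewrite adj_sym.
have e04 : adj (c i) (c (i + 4)) by rewrite adj_sym.
have off5 : [&& c i \notin S, c (i + 1) \notin S, c (i + 2) \notin S, c (i + 3) \notin S
    & c (i + 4) \notin S].
  by rewrite !c_off.
case: (heavy_chain ff Smax (c_off i) hi (c_off _) (c_off _) e04 e01) => sub.
  have [|v [k [s]]] := heavy_pentagon_nbrs off5 e01 (next 1) (next 2) (next 3) e40 d14 _ hi sub.
    by rewrite eq_sym.
  rewrite !inE => -[lv v_in k_in sS [sv sk kv]].
  have [a def_v] : exists a, v = c a by case/orP: v_in => /eqP ->; eexists.
  have [b def_k] : exists b, k = c b by case/or3P: k_in => /eqP ->; eexists.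
  by exists a, b, s; rewrite -def_v -def_k.
have off5' : [&& c i \notin S, c (i + 4) \notin S, c (i + 3) \notin S, c (i + 2) \notin S
    & c (i + 1) \notin S].
  by rewrite !c_off.
have [||v [k [s]]] := heavy_pentagon_nbrs off5' e04 (back 3) (back 2) (back 1) e10 _ _ hi sub.
- by rewrite eq_sym.
- by rewrite eq_sym.
rewrite !inE => -[lv v_in k_in sS [sv sk kv]].
have [a def_v] : exists a, v = c a by case/orP: v_in => /eqP ->; eexists.
have [b def_k] : exists b, k = c b by case/or3P: k_in => /eqP ->; eexists.
by exists a, b, s; rewrite -def_v -def_k.
Qed.

End OddComponent.

(** * Components *)

Section Components.
Variable G : sgraph.
Implicit Types (X Y K L : {set G}).

Definition adj_in X : rel G := fun x y => [&& x \in X, y \in X & adj x y].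

Definition closed_in X K :=
  {in K & X, forall x y, adj x y -> y \in K}.

Definition component X K :=
  [&& K != set0, K \subset X, [forall x in K, forall y in X, adj x y ==> (y \in K)]
    & [forall x in K, forall y in K, connect (adj_in K) x y]].

Lemma componentP X K :
  reflect [/\ K != set0, K \subset X, closed_in X K
            & {in K &, forall x y, connect (adj_in K) x y}]
          (component X K).
Proof.
apply: (iffP and4P) => -[K0 KX cl co]; split=> //.
- by move=> x y xK yX; move/forall_inP: cl => /(_ x xK)/forall_inP/(_ y yX)/implyP.
- by move=> x y xK yK; move/forall_inP: co => /(_ x xK)/forall_inP/(_ y yK).
- apply/forall_inP=> x xK; apply/forall_inP=> y yX; apply/implyP; exact: cl.
- apply/forall_inP=> x xK; apply/forall_inP=> y yK; exact: co.
Qed.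

Lemma connect_inS X Y x y : X \subset Y ->
  connect (adj_in X) x y -> connect (adj_in Y) x y.
Proof.
move=> sXY; apply: connect_sub => a b /and3P [aX bX ab]; apply: connect1.
by rewrite /adj_in !(subsetP sXY).
Qed.

Lemma connect_in_sym X : connect_sym (adj_in X).
Proof.
by apply: sym_connect_sym => x y; rewrite /adj_in adj_sym andbCA.
Qed.

Lemma closed_in_connect X Y x y : closed_in X Y -> x \in Y ->
  connect (adj_in X) x y -> y \in Y.
Proof.
move=> cl xY /connectP [p]; elim: p x xY => [|z p IHp] x xY /= => [_ -> // |].
by case/andP=> /and3P [_ zX xz]; apply: IHp; apply: cl xz.
Qed.

Lemma path_closed X Y x p : closed_in X Y -> x \in Y ->
  path (adj_in X) x p -> path (adj_in Y) x p.
Proof.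
move=> cl; elim: p x => //= y p IHp x xY /andP [/and3P [xX yX xy] path_p].
have yY : y \in Y by apply: cl xy.
by rewrite /adj_in xY yY xy IHp.
Qed.

Lemma component_exists X x : x \in X -> exists2 K, component X K & x \in K.
Proof.
move=> xX; pose K := [set y | connect (adj_in X) x y].
have xK : x \in K by rewrite inE connect0.
have cl : closed_in X K.
  move=> y z; rewrite !inE => xy zX yz; apply: (connect_trans xy); apply: connect1.
  rewrite /adj_in yz zX !andbT; apply: closed_in_connect xX xy.
  by move=> ? ? _.
exists K => //; apply/componentP; split=> //.
- by apply/set0Pn; exists x.
- by apply/subsetP=> y; rewrite inE; apply: closed_in_connect xX => ? ? _.
have root y : y \in K -> connect (adj_in K) x y.
  rewrite inE => /connectP [p path_p ->]; apply/connectP; exists p => //.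
  exact: path_closed path_p.
move=> y z yK zK; apply: connect_trans (root z zK).
by rewrite connect_in_sym root.
Qed.

Lemma component_unique X K L x :
  component X K -> component X L -> x \in K -> x \in L -> K = L.
Proof.
suff sub K' L' : component X K' -> component X L' -> x \in K' -> x \in L' -> K' \subset L'.
  by move=> cK cL xK xL; apply/eqP; rewrite eqEsubset !sub.
move=> /componentP [_ KX _ co] /componentP [_ _ cl _] xK xL; apply/subsetP=> y yK.
by apply: closed_in_connect cl xL _; apply: connect_inS KX _; apply: co.
Qed.

Lemma odd_component X : odd_in X -> exists2 K, component X K & odd_in K.
Proof.
case/exists_inP=> x xX turn; have [K cK xK] := component_exists xX.
exists K => //; have [_ _ cl _] := componentP _ _ cK.
apply/exists_inP; exists x => //; case/connectP: turn => p path_p last_p.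
apply/connectP; exists p => //; move: (x, true) (xK : (x, true).1 \in K) path_p {last_p}.
elim: p => //= b p IHp a aK /andP [/and4P [ab aX bX eb]].
have bK : b.1 \in K by apply: cl ab.
by rewrite /step_in ab aK bK eb; apply: IHp.
Qed.

End Components.

(** * Odd cycles *)

(** What is used below of the fact that the subgraph induced on [K] is an odd cycle; unlike
[shortest_odd_walk], it does not depend on a parametrization. *)
Record odd_cycle (G : sgraph) (K : {set G}) : Prop := OddCycle {
  cycle_nbrs : forall x, x \in K ->
    exists a b, a != b /\ nbrs x :&: K = [set a; b];
  cycle_delete_connected : forall x, x \in K ->
    {in K :\ x &, forall y z, connect (adj_in (K :\ x)) y z};
  cycle_delete_not_odd : forall x, x \in K -> ~~ odd_in (K :\ x)
}.

Section OddCycle.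
Variables (G : sgraph) (K : {set G}) (n : nat) (c : nat -> G).
Hypothesis tf : triangle_free G.
Hypothesis cP : shortest_odd_walk K n c.
Hypothesis onto : forall x, x \in K -> exists i, x = c i.

Let n_gt4 : 4 < n := walk_length cP tf.

Lemma onto_from i x : x \in K -> exists2 a, a < n & x = c (i + a).
Proof.
case/onto=> j ->; exists ((j + i * (n - 1)) %% n); first by rewrite ltn_pmod; lia.
rewrite -(walk_wrap cP j i) -[RHS](walk_wrap cP _ ((j + i * (n - 1)) %/ n)).
rewrite -addnA [_ %% n + _]addnC -divn_eq.
by congr c; case: n n_gt4 => // n' _; rewrite subn1 /=; lia.
Qed.

Lemma next_walk i : adj (c i) (c (i + 1)).
Proof. by rewrite addn1; apply: (sow_adj cP). Qed.

Lemma prev_walk i : adj (c i) (c (i + (n - 1))).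
Proof.
rewrite adj_sym; have := sow_adj cP (i + (n - 1)).
by rewrite (_ : (i + (n - 1)).+1 = i + n) ?(sow_period cP) //; lia.
Qed.

Lemma odd_cycle_nbrs x : x \in K ->
  exists a b, a != b /\ nbrs x :&: K = [set a; b].
Proof.
case/onto=> i ->; exists (c (i + 1)), (c (i + (n - 1))); split.
  have := @walk_inj _ _ _ _ cP (i + 1) (n - 2); rewrite -addnA.
  by rewrite (_ : 1 + (n - 2) = n - 1); [apply; lia | lia].
apply/setP=> y; rewrite !inE; apply/andP/orP => [[xy yK] | [] /eqP ->].
- have [a a_lt def_y] := onto_from i yK.
  case: (posnP a) => [a0 | a_gt0]; first by rewrite def_y a0 addn0 adj_irrefl in xy.
  rewrite def_y in xy *.
  case: (walk_chordless cP tf _ xy) => [|-> | <-]; first by lia.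
    by left.
  by right; rewrite subn1.
- by rewrite next_walk (sow_in cP).
- by rewrite prev_walk (sow_in cP).
Qed.

Lemma odd_cycle_delete_connected x : x \in K ->
  {in K :\ x &, forall y z, connect (adj_in (K :\ x)) y z}.
Proof.
case/onto=> i ->.
have arc a : 0 < a < n -> connect (adj_in (K :\ c i)) (c (i + 1)) (c (i + a)).
  elim: a => // a IHa a_lt; case: (posnP a) => [-> | a_gt0]; first exact: connect0.
  apply: connect_trans (IHa _) _; first by lia.
  apply: connect1; rewrite /adj_in !inE !(sow_in cP) !andbT addnS (sow_adj cP) andbT.
  by rewrite -addnS ![_ == c i]eq_sym !(walk_inj cP) //; lia.
have from_start y : y \in K :\ c i -> connect (adj_in (K :\ c i)) (c (i + 1)) y.
  case/setD1P=> yi yK; have [a a_lt def_y] := onto_from i yK.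
  rewrite def_y; apply: arc; rewrite a_lt andbT lt0n.
  by apply: contraNneq yi => a0; rewrite def_y a0 addn0.
move=> y z /from_start y1 /from_start; apply: connect_trans.
by rewrite connect_in_sym.
Qed.

(** The vertices other than [x = c i] are coloured by the parity of their index counted from
[i]; as the cycle has no chords, only consecutive ones are adjacent. *)
Lemma odd_cycle_delete_not_odd x : x \in K -> ~~ odd_in (K :\ x).
Proof.
case/onto=> i ->; pose s := [seq c (i + k) | k <- iota 0 n].
have idx a : a < n -> index (c (i + a)) s = a.
  move=> a_lt; have -> : c (i + a) = nth (c i) s a.
    by rewrite (nth_map 0) ?size_iota ?nth_iota.
  apply: index_uniq; first by rewrite size_map size_iota.
  rewrite map_inj_in_uniq ?iota_uniq // => k l; rewrite !mem_iota0; move: k l.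
  apply: gap_ind => [k l IH ln kn /esym /IH -> // | k l kn ln].
  rewrite addnA => /eqP; apply: contraTeq => kl.
  by apply: (walk_inj cP); lia.
apply: (@coloring_not_odd _ _ (fun y => odd (index y s))) => y z.
case/setD1P=> yi yK /setD1P [zi zK].
have [a a_lt def_y] := onto_from i yK; have [b b_lt def_z] := onto_from i zK.
have a_gt0 : 0 < a by rewrite lt0n; apply: contraNneq yi => a0; rewrite def_y a0 addn0.
have b_gt0 : 0 < b by rewrite lt0n; apply: contraNneq zi => b0; rewrite def_z b0 addn0.
rewrite def_y def_z !idx //.
clear yi yK zi zK def_y def_z; move: a b a_lt b_lt a_gt0 b_gt0.
apply: gap_ind => [a b IH bn an b0 a0 | a k an kn a0 _].
  by rewrite adj_sym eq_sym; apply: IH.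
rewrite addnA; case: (posnP k) => [-> | k0 ak]; first by rewrite addn0 adj_irrefl.
case: (walk_chordless cP tf _ ak) => [|-> | ]; [lia | | lia].
by rewrite addn1 /=; case: odd.
Qed.

End OddCycle.

(** * Exchanges in optimal stable sets *)

Definition degree_sum (G : sgraph) (S : {set G}) := \sum_(x in S) #|nbrs x|.

Definition odd_components (G : sgraph) (X : {set G}) :=
  [set K | component X K && odd_in K].

(** Among the maximum stable sets those of least degree sum are selected first, so that a
vertex of [S] cannot be exchanged for one of smaller degree; among these, the ones whose
complement has the fewest odd components. *)
Definition optimal (G : sgraph) (S : {set G}) :=
  [/\ max_stable S,
      forall T : {set G}, max_stable T -> degree_sum S <= degree_sum T &
      forall T : {set G}, max_stable T -> degree_sum T = degree_sum S ->
        #|odd_components (~: S)| <= #|odd_components (~: T)|].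

Lemma optimal_exists (G : sgraph) : exists S : {set G}, optimal S.
Proof.
have st0 : stable (set0 : {set G}) by apply/stableP=> x y; rewrite inE.
have [S0 stS0 maxS0] := arg_maxnP (fun S : {set G} => #|S|) st0.
pose ms (S : {set G}) := stable S && (#|S| == #|S0|).
have msP (S : {set G}) : reflect (max_stable S) (ms S).
  apply: (iffP andP) => [[stS /eqP cardS] | [stS maxS]].
    by split=> // I; rewrite cardS; apply: maxS0.
  by rewrite eqn_leq maxS ?andbT //; split=> //; apply: maxS0.
have ms0 : ms S0 by apply/andP.
have [S1 msS1 minS1] := arg_minnP (@degree_sum G) ms0.
have ms1 : ms S1 && (degree_sum S1 == degree_sum S1) by rewrite msS1 /=.
have [S /andP [/msP msS /eqP degS] minS] := @arg_minnP _ S1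
  (fun S => ms S && (degree_sum S == degree_sum S1)) (fun S => #|odd_components (~: S)|) ms1.
exists S; split=> // T /msP msT; first by rewrite degS minS1.
by rewrite degS => /eqP degT; apply: minS; rewrite msT.
Qed.

Section Core.
Variable G : sgraph.
Hypothesis tf : triangle_free G.
Hypothesis ff : fork_free G.
Hypothesis und : undominated G.
Hypothesis deg3 : forall u : G, 2 < #|nbrs u|.
Implicit Types (S K : {set G}).

Section Structure.
Variables (S K : {set G}).
Hypothesis Smax : max_stable S.
Hypothesis compK : component (~: S) K.
Hypothesis oddK : odd_in K.

Lemma component_off x : x \in K -> x \notin S.
Proof. by case/componentP: compK => _ /subsetP sub _ _ /sub; rewrite inE. Qed.

Lemma component_in x y : x \in K -> y \notin S -> adj x y -> y \in K.
Proof.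
by case/componentP: compK => _ _ cl _ xK yS; apply: cl => //; rewrite inE.
Qed.

(** The component is connected and [no_off_cycle] forbids leaving the shortest odd cycle. *)
Lemma odd_component_walk : exists n c,
  shortest_odd_walk K n c /\ forall x, x \in K -> exists i, x = c i.
Proof.
have [n [c cP]] := shortest_odd_walk_exists oddK; exists n, c; split=> // x xK.
have [_ _ _ conn] := componentP _ _ compK.
have {conn} := conn _ _ (sow_in cP 0) xK; case/connectP=> p.
elim: p 0 => [|y p IHp] i /= => [_ -> | /andP [/and3P [_ yK iy] path_p] def_x].
  by exists i.
have [j def_y] : exists j, y = c j.
  apply: (no_off_cycle tf ff und Smax component_off component_in cP (i := i)).
    exact: component_off.
  by rewrite adj_sym.
by rewrite def_y in path_p def_x; apply: (IHp j).
Qed.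

Lemma odd_component_cycle : odd_cycle K.
Proof.
have [n [c [cP onto]]] := odd_component_walk; split.
- exact: (odd_cycle_nbrs tf cP onto).
- exact: (odd_cycle_delete_connected tf cP onto).
- exact: (odd_cycle_delete_not_odd tf cP onto).
Qed.

Lemma light_degree x : x \in K -> light S x -> #|nbrs x| = 3.
Proof.
move=> xK /andP [xS /eqP lx]; have [a [b [ab def_nbrs]]] := cycle_nbrs odd_component_cycle xK.
have offS : nbrs x :\: S = nbrs x :&: K.
  apply/setP=> y; rewrite !inE andbC; case xy: (adj x y) => //=.
  by apply/idP/idP=> [yS | ]; [apply: component_in xy | apply: component_off].
by rewrite -(cardsID S) lx offS def_nbrs cards2 ab.
Qed.

(** All that is retained of the pentagon is that the vertices at distance two from a given
one are adjacent to each other. *)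
Lemma light_or_pentagon x : x \in K -> light S x \/
  exists v k s, [/\ [&& v \in K, k \in K & k != v], light S v,
    [&& s \in S, adj s v & adj s k] &
    {in K &, forall a b, a != b -> ~~ adj v a -> ~~ adj v b -> v != a -> v != b -> adj a b}].
Proof.
have [n [c [cP onto]]] := odd_component_walk; move=> xK; have [i ->] := onto x xK.
have := light_or_shared tf ff und Smax component_off component_in cP i.
case=> [li | [n5 [j [k [s [lj sS sj sk kj]]]]]]; first by left.
right; exists (c j), (c k), s; split=> //; first by rewrite !(sow_in cP).
  by rewrite sS sj.
move=> a b aK bK ab ja jb ja' jb'.
have middle d : d \in K -> ~~ adj (c j) d -> c j != d -> d = c (j + 2) \/ d = c (j + 3).
  move=> dK jd jd'; have [m m_lt def_d] := onto_from tf cP onto j dK.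
  have m0 : m <> 0 by move=> m0; rewrite def_d m0 addn0 eqxx in jd'.
  have m1 : m <> 1 by move=> m1; rewrite def_d m1 (next_walk cP) in jd.
  have m4 : m <> n - 1 by move=> m4; rewrite def_d m4 (prev_walk tf cP) in jd.
  have m23 : m = 2 \/ m = 3 by clear -m_lt n5 m0 m1 m4; lia.
  by case: m23 def_d => -> ->; [left | right].
have adj23 : adj (c (j + 2)) (c (j + 3)) by rewrite [j + 3]addnS; apply: (sow_adj cP).
case: (middle a aK ja ja') (middle b bK jb jb') ab => [] -> [] ->; rewrite ?eqxx // => _.
by rewrite adj_sym.
Qed.

End Structure.

Section Swap.
Variables (S K : {set G}) (w s : G).
Hypothesis Sopt : optimal S.
Hypothesis compK : component (~: S) K.
Hypothesis oddK : odd_in K.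
Hypotheses (wK : w \in K) (lw : light S w) (sS : s \in S) (sw : adj s w).

Let Smax : max_stable S. Proof. by case: Sopt. Qed.
Let wS : w \notin S. Proof. exact: component_off compK _ wK. Qed.
Let S' := w |: (S :\ s).

Lemma in_swap x : (x \in S') = (x == w) || (x != s) && (x \in S).
Proof. by rewrite !inE. Qed.

Lemma swap_max : max_stable S'.
Proof.
have [stS maxS] := Smax; split=> [|I /maxS]; last first.
  rewrite /S' cardsU1 !inE (negPf wS) andbF /= => le_IS.
  by move: le_IS; rewrite (cardsD1 s S) sS.
have no_w x : x \in S :\ s -> ~~ adj w x.
  case/setD1P=> xs xS; apply: contra xs => wx; apply/eqP.
  by apply: light_nbr lw xS sS wx _; rewrite adj_sym.
apply/stableP=> x y /setU1P [-> | xS] /setU1P [-> | yS]; rewrite ?adj_irrefl //.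
- exact: no_w.
- by rewrite adj_sym no_w.
- by move: xS yS => /setD1P [_ xS] /setD1P [_ yS]; apply: (max_stable_adj Smax).
Qed.

(** The vertex [w] has degree three; a larger degree of [s] would contradict the choice of
[S], and a smaller one the minimum degree. *)
Lemma swap_degree : #|nbrs s| = 3 /\ degree_sum S' = degree_sum S.
Proof.
have [_ minS _] := Sopt; have := minS _ swap_max.
rewrite /degree_sum (big_setD1 s sS) big_setU1 /=; last by rewrite !inE (negPf wS) andbF.
rewrite (light_degree Smax compK oddK wK lw) leq_add2r => le_s.
by have -> : #|nbrs s| = 3 by apply/eqP; rewrite eqn_leq le_s deg3.
Qed.

(** A component of the complement of [S'] that avoids [s] does not meet [w] either.  If it
were not a component of the complement of [S], it would have an edge to [w] and lie in
the path that remains of [K] without [w]. *)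
Lemma swap_component L : component (~: S') L -> odd_in L -> s \notin L ->
  component (~: S) L /\ L != K.
Proof.
case/componentP=> L0 LS' clL coL oddL sL.
have offL x : x \in L -> x \notin S /\ x != w.
  move=> xL; have := subsetP LS' x xL; rewrite inE in_swap negb_or => /andP [-> +].
  by rewrite negb_and negbK; case: eqP => [xs | //]; rewrite -xs xL in sL.
have onL x y : x \in L -> y \notin S -> y != w -> adj x y -> y \in L.
  move=> xL yS yw xy; apply: clL xy => //.
  by rewrite inE in_swap (negPf yw) (negPf yS) andbF.
have wL : w \notin L by apply/negP=> /offL []; rewrite eqxx.
have clL' : closed_in (~: S) L.
  move=> x y xL; rewrite inE => yS xy; case: (altP (y =P w)) => [yw | ]; last first.
    by move=> yw; apply: onL xy.
  have xK : x \in K.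
    by have [xS _] := offL x xL; apply: (component_in compK wK xS); rewrite -yw adj_sym.
  have : L \subset K :\ w.
    apply/subsetP=> z zL; rewrite !inE (offL z zL).2 /=.
    have [_ _ clK _] := componentP _ _ compK.
    apply: closed_in_connect clK xK _; apply: connect_inS (coL x z xL zL).
    by apply/subsetP=> a /offL []; rewrite inE.
  move/odd_inS => /(_ oddL).
  by rewrite (negPf (cycle_delete_not_odd (odd_component_cycle Smax compK oddK) wK)).
split; last by apply: contraNneq wL => ->.
apply/componentP; split=> //.
by apply/subsetP=> x /offL []; rewrite inE.
Qed.

(** The exchange destroys [K] and creates at most one odd component, that of [s].  By the
choice of [S] the number of odd components does not drop, so the component of [s] is
odd, and the number stays the same. *)
Lemma swap_optimal : optimal S' /\
  exists2 C, component (~: S') C /\ odd_in C & s \in C.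
Proof.
have [_ degS'] := swap_degree; have [_ minS minK] := Sopt.
have sS' : s \in ~: S'.
  by rewrite inE in_swap eqxx orbF; apply: contraNneq wS => <-.
have [C compC sC] := component_exists sS'.
pose Q := odd_components (~: S) :\ K.
have KQ : K \in odd_components (~: S) by rewrite inE compK.
have cardQ : #|odd_components (~: S)| = #|Q|.+1 by rewrite (cardsD1 K) KQ.
have sub L : L \in odd_components (~: S') -> L = C \/ L \in Q.
  rewrite inE => /andP [compL oddL]; case: (boolP (s \in L)) => [sL | sL].
    by left; apply: component_unique compL compC sL sC.
  by right; have [compL' LK] := swap_component compL oddL sL; rewrite !inE LK compL' oddL.
have le_K := minK _ swap_max degS'.
have oddC : odd_in C.
  apply: contraLR le_K => evenC; rewrite -ltnNge cardQ ltnS; apply: subset_leq_card.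
  apply/subsetP=> L LO; case: (sub L LO) => // LC.
  by move: LO; rewrite LC inE (negPf evenC) andbF.
split; last by exists C.
split=> [|T|T Tmax]; first exact: swap_max.
  by rewrite degS'; apply: minS.
rewrite degS' => degT; apply: leq_trans (minK _ Tmax degT); rewrite cardQ.
apply: leq_trans (_ : #|C |: Q| <= _); last by rewrite cardsU1; case: (C \notin Q).
by apply/subset_leq_card/subsetP=> L /sub [-> | LQ]; rewrite in_setU1 ?eqxx ?LQ ?orbT.
Qed.

End Swap.

(** Otherwise [K] is a pentagon with a light vertex [v] whose neighbour [s] in [S] is adjacent
to a further vertex [k] of [K].  After exchanging [v] and [s] the component of [s] is an
odd cycle, so the second neighbour [t] of [s] on it is connected to [k] avoiding [s] and
[v], hence lies in [K].  Then [v], [k], [t] are three pairwise non-adjacent vertices of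
a pentagon. *)
Lemma optimal_light S K x : optimal S -> component (~: S) K -> odd_in K -> x \in K ->
  light S x.
Proof.
move=> Sopt compK oddK xK; have [Smax _ _] := Sopt.
case: (light_or_pentagon Smax compK oddK xK) => // -[v [k [s]]].
case=> /and3P [vK kK kv] lv /and3P [sS sv sk] no_triple.
have [[S'max _ _] [C [compC oddC] sC]] := swap_optimal Sopt compK oddK vK lv sS sv.
have cycC := odd_component_cycle S'max compC oddC.
have [a [b [ab def_nbrs]]] := cycle_nbrs cycC sC.
have nonadj y z : adj s y -> adj s z -> ~~ adj y z.
  by move=> sy sz; apply: tf sz; rewrite adj_sym.
have off y : y \in C :\ s -> y \in ~: S.
  case/setD1P=> ys /(component_off compC).
  by rewrite in_swap ys negb_or inE => /andP [].
have offv y : y \in C -> y != v.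
  by move/(component_off compC); rewrite in_swap negb_or => /andP [].
have ss y : adj s y -> y != s by apply: contraTneq => ->; rewrite adj_irrefl.
have kC : k \in C.
  apply: (component_in compC sC) => //; rewrite in_swap (negPf kv) negb_and /=.
  by rewrite (component_off compK) ?orbT.
have [t [tC st tk]] : exists t, [/\ t \in C, adj s t & t != k].
  have [aN bN] : a \in nbrs s :&: C /\ b \in nbrs s :&: C.
    by rewrite def_nbrs !inE !eqxx orbT.
  case: (altP (a =P k)) => [ak | ak]; [exists b | exists a].
    by move: bN; rewrite !inE -ak eq_sym ab => /andP [].
  by move: aN; rewrite !inE => /andP [].
have tK : t \in K.
  have [_ _ clK _] := componentP _ _ compK; apply: closed_in_connect clK kK _.
  apply: (@connect_inS _ (C :\ s)); first by apply/subsetP=> y /off.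
  by apply: (cycle_delete_connected cycC sC); rewrite !inE ss.
by have := no_triple k t kK tK; rewrite eq_sym tk ![v == _]eq_sym kv offv // !nonadj //;
  move=> /(_ isT isT isT isT isT); rewrite (negPf (nonadj _ _ sk st)).
Qed.

(** * The walk of exchanges *)

(** The state of a walk of exchanges: [K] is the current odd cycle, entered at [e], and [D]
is the set of vertices that the walk has left behind.  By [dead_nbrs] a vertex [v] that
closes a path in [D] to a cycle has no neighbours outside [D] other than [e]; this keeps
the walk from returning to [D]. *)
Record dead_end (S K : {set G}) (e : G) (D : {set G}) : Prop := DeadEnd {
  dead_optimal : optimal S;
  dead_component : component (~: S) K;
  dead_odd : odd_in K;
  dead_entry : e \in K;
  dead_off : D \subset ~: S;
  dead_closed : closed_in (~: S) D;
  dead_disjoint : [disjoint D & K];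
  dead_nbrs : forall v p q, v \notin D -> p \in D -> q \in D -> p != q ->
    adj v p -> adj v q -> connect (adj_in D) p q -> nbrs v \subset e |: D
}.

(** Exchange some [w] in [K] other than [e] with its neighbour [s] in [S].  The new odd cycle
[C] is disjoint from [K], since distinct light vertices have distinct neighbours in [S].
It is also disjoint from [D]: otherwise [s] closes a path in [D], and its neighbour [w]
is neither in [D] nor equal to [e].  So the walk enters [C] at [s], and what remains of
[K] is left behind; the vertex that closes it to a cycle is [w], whose neighbours are
two vertices of [K] and [s]. *)
Lemma dead_end_step S K e D : dead_end S K e D ->
  exists S' K' e' D', dead_end S' K' e' D' /\ D \proper D'.
Proof.
case=> Sopt compK oddK eK DS clD disDK deadD; have [Smax _ _] := Sopt.
have cycK := odd_component_cycle Smax compK oddK.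
have [w wK we] : exists2 w, w \in K & w != e.
  have [a [b [_ def_nbrs]]] := cycle_nbrs cycK eK.
  have : a \in nbrs e :&: K by rewrite def_nbrs !inE eqxx.
  rewrite !inE => /andP [ea aK]; exists a => //.
  by apply: contraTneq ea => ->; rewrite adj_irrefl.
have lightK x := @optimal_light S K x Sopt compK oddK.
have wS := component_off compK wK.
have [s sS] := max_stable_nbr Smax wS; rewrite adj_sym => sw.
have [S'opt [C [compC oddC] sC]] := swap_optimal Sopt compK oddK wK (lightK w wK) sS sw.
set S' := w |: (S :\ s) in S'opt compC; have [S'max _ _] := S'opt.
have cycC := odd_component_cycle S'max compC oddC.
have inS' x : (x \in S') = (x == w) || (x != s) && (x \in S) by rewrite !inE.
have offK x : x \in K -> x \notin S by apply: component_off compK x.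
have offD x : x \in D -> x \notin S by move/(subsetP DS); rewrite inE.
have offC x : x \in C -> x != s -> x \notin S /\ x != w.
  by move/(component_off compC); rewrite inS' negb_or => /andP [-> +] xs; rewrite xs.
have KD x : x \in K -> x \notin D by move=> xK; apply/negP=> /(disjointFr disDK); rewrite xK.
have wD := KD w wK.
have sD : s \notin D by apply: contraL sS; apply: offD.
have [a [b [ab def_nbrs]]] := cycle_nbrs cycC sC.
have nbrC x : x \in [set a; b] -> adj s x /\ x \in C :\ s.
  rewrite -def_nbrs !inE => /andP [sx ->]; split=> //; rewrite andbT.
  by apply: contraTneq sx => ->; rewrite adj_irrefl.
have [[sa aC] [sb bC]] : (adj s a /\ a \in C :\ s) /\ (adj s b /\ b \in C :\ s).
  by split; apply: nbrC; rewrite !inE eqxx ?orbT.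
have connC Y x y : closed_in (~: S) Y -> x \in C :\ s -> y \in C :\ s -> x \in Y -> y \in Y.
  move=> clY xC yC xY; apply: closed_in_connect clY xY _.
  apply: connect_inS (cycle_delete_connected cycC sC xC yC).
  by apply/subsetP=> z /setD1P [zs zC]; rewrite inE (offC z zC zs).1.
have clK : closed_in (~: S) K by case/componentP: compK.
have sK : s \notin K by apply: contraL sS; apply: offK.
have disCK x : x \in C -> x \notin K.
  move=> xC; apply/negP=> xK; have xs : x != s by apply: contraNneq sK => <-.
  have aK : a \in K by apply: (connC K x) xK => //; rewrite !inE xs.
  have aw : a = w.
    by apply: (light_inj Smax tf (lightK _ aK) (lightK _ wK) sS); rewrite adj_sym.
  by move/setD1P: aC => [a_s /offC /(_ a_s) []]; rewrite aw eqxx.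
have disCD x : x \in C -> x \notin D.
  move=> xC; apply/negP=> xD; have xs : x != s by apply: contraNneq sD => <-.
  have subD y : y \in C :\ s -> y \in D.
    by move=> yC; apply: (connC D x) => //; rewrite !inE xs.
  have conn : connect (adj_in D) a b.
    apply: connect_inS (cycle_delete_connected cycC sC aC bC); exact/subsetP.
  have /subsetP/(_ w) := deadD s a b sD (subD a aC) (subD b bC) ab sa sb conn.
  by rewrite !inE sw (negPf we) (negPf wD) => /(_ isT).
have sC' x y : x \in C -> y \in ~: S' -> adj x y -> y \in C.
  by rewrite inE; apply: (component_in compC).
have D'S' : D :|: K :\ w \subset ~: S'.
  apply/subsetP=> x /setUP [xD | /setD1P [xw xK]]; rewrite inE inS' negb_or negb_and.
    by rewrite offD // orbT andbT; apply: contraNneq wD => <-.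
  by rewrite xw offK // orbT.
exists S', C, s, (D :|: K :\ w); split; last first.
  apply/properP; split; first exact: subsetUl.
  by exists e; rewrite ?KD // !inE eK eq_sym we orbT.
split=> //.
- move=> x y xD' yS' xy; case: (altP (y =P s)) => [ys | ys].
    have xC : x \in C.
      by apply: (sC' s) => //; [apply: (subsetP D'S') | rewrite -ys adj_sym].
    by move: xD'; rewrite !inE (negPf (disCD x xC)) (negPf (disCK x xC)) andbF.
  move: yS'; rewrite inE inS' negb_or negb_and ys /= => /andP [yw yS].
  have {}yS : y \in ~: S by rewrite inE.
  case/setUP: xD' => [xD | /setD1P [xw xK]]; rewrite !inE; first by rewrite (clD x y).
  by rewrite yw (clK x y) ?orbT.
- apply/pred0P=> x /=; apply/negP=> /andP [xD' xC].
  by move: xD'; rewrite !inE (negPf (disCD x xC)) (negPf (disCK x xC)) andbF.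
move=> v p q vD' pD' qD' pq vp vq conn.
have same Y : closed_in (D :|: K :\ w) Y -> p \in Y -> q \in Y.
  by move=> clY pY; apply: closed_in_connect clY pY conn.
have D'off x : x \in D :|: K :\ w -> x \in ~: S.
  by case/setUP=> [/(subsetP DS) // | /setD1P [_ /offK]]; rewrite inE.
have clD' : closed_in (D :|: K :\ w) D by move=> x y xD /D'off; apply: clD.
have [pD | pK] : p \in D \/ p \in K :\ w by apply/setUP.
  have vD : v \notin D by apply: contra vD'; rewrite inE => ->.
  have conn' : connect (adj_in D) p q.
    have [r path_r ->] := connectP conn; apply/connectP; exists r => //.
    exact: path_closed path_r.
  apply: subset_trans (deadD v p q vD pD (same D clD' pD) pq vp vq conn') _.
  apply/subsetP=> x /setU1P [-> | xD]; rewrite !inE ?xD ?orbT //.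
  by rewrite [e == w]eq_sym we eK !orbT.
have qK : q \in K.
  apply: same (setD1P pK).2 => x y xK /D'off; exact: clK.
have [_ pK'] := setD1P pK.
have vw : v = w.
  case: (boolP (v \in S)) => [vS | vS].
    case/eqP: pq; apply: (light_inj Smax tf (lightK _ pK') (lightK _ qK) vS);
      by rewrite adj_sym.
  have vK : v \in K by apply: (component_in compK pK') => //; rewrite adj_sym.
  by apply/eqP; apply: contraNT vD' => vw; rewrite !inE vw vK orbT.
rewrite vw; apply/subsetP=> x; rewrite inE => wx; rewrite !inE.
case: (boolP (x \in S)) => [xS | xS].
  by rewrite (light_nbr (lightK w wK) xS sS wx) ?eqxx // adj_sym.
rewrite (component_in compK wK xS wx) andbT.
by rewrite (_ : x != w) ?orbT //; apply: contraTneq wx => ->; rewrite adj_irrefl.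
Qed.

(** Since [D] grows with each exchange, the complement of an optimal set has no odd
component; it is coloured with two colours and the set itself with a third. *)
Lemma core_colorable : colorable G 3.
Proof.
have [S Sopt] := optimal_exists G.
case: (boolP (odd_in (~: S))) => [oddS | evenS].
  have [K compK oddK] := odd_component oddS.
  have [e eK] : exists e, e \in K by apply/set0Pn; case/componentP: compK.
  have : dead_end S K e set0.
    split=> //; rewrite ?sub0set ?disjoints0 //.
    - by move=> x y; rewrite inE.
    - by rewrite -setI_eq0 set0I.
    - by move=> v p q _; rewrite inE.
  have [m] := ubnP #|~: (set0 : {set G})|.
  elim: m S K e (set0 : {set G}) {Sopt oddS compK oddK eK} => // m IHm S K e D.
  rewrite ltnS => le_m /dead_end_step [S' [K' [e' [D' [dead' prop]]]]].
  apply: IHm dead'; apply: leq_trans le_m; apply: proper_card.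
  by rewrite properE !setCS -properE.
have [c cP] := odd_in_coloring evenS; have [[/stableP stS _] _ _] := Sopt.
apply: (@colorable_proper _ _ (fun x => if x \in S then ord0 else
  lift ord0 (if c x then ord0 else lift ord0 ord0 : 'I_2))) => x y xy.
case: (boolP (x \in S)) => xS; case: (boolP (y \in S)) => yS //.
  by have := stS x y xS yS; rewrite xy.
have := cP x y; rewrite !inE => /(_ xS yS xy).
by case: (c x) (c y) => [] [].
Qed.

End Core.

Theorem theorem1p2 (G : sgraph)
    (hK3 : ~ has_induced G (complete 3))
    (hfork : ~ has_induced G fork) :
  chromatic_number G <= 3.
Proof.
rewrite /chromatic_number; case: ex_minnP => k _; apply.
apply: (@colorable3_reduction (fun H => triangle_free H /\ fork_free H)).
- move=> H u [tf ff]; split; first by move=> x y z; apply: tf.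
  by move=> v p x q y g h gh; apply: ff.
- by move=> H [tf ff] und deg; apply: core_colorable.
by split; [apply: triangle_freeP | apply: fork_freeP => //; apply: triangle_freeP].
Qed.
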